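(* Let $\mathcal{C}_{\max}$ be the maximum element-wise curvature of $f(S)=\mathrm{Tr}(\mathbf{P}-\mathbf{F}_S^{-1})$, $S\subseteq[n]$. Assume that $\|\mathbf{h}_j\|_2^2\le C$ for all $j\in[n]$. (i) If $$\lambda_{\max}(\mathbf{H}^\top\mathbf{H})\le\left(\frac1\phi-\frac{1}{\lambda_{\min}(\mathbf{P})}\right)\min_{j\in[n]}\sigma_j^2$$ for some $0<\phi<\lambda_{\min}(\mathbf{P})$, then $$\mathcal{C}_{\max}\le\max_{j\in[n]}\frac{\lambda_{\max}(\mathbf{P})^2\,(\sigma_j^2+\lambda_{\max}(\mathbf{P})\,C)}{\phi^2\,(\sigma_j^2+\phi\, C)}.$$ (ii) Suppose furthermore that $\mathbf{h}_1,\dots,\mathbf{h}_n$ are i.i.d. zero-mean random vectors in $\mathbb{R}^m$ with covariance matrix $\sigma_h^2\mathbf{I}_m$, where $\sigma_h^2<C$ (with $\|\mathbf{h}_j\|_2^2\le C$ almost surely, and $\mathbf{P}$, $\sigma_1^2,\dots,\sigma_n^2$ deterministic). Then for every $q>0$, with probability at least $$1-m\exp\left(\frac{-q^2/2}{(C-\sigma_h^2)(n\sigma_h^2+q/3)}\right),$$ the condition in (i), and hence the bound on $\mathcal{C}_{\max}$ in (i), holds with $$\phi=\min_{j\in[n]}\left(\frac{1}{\lambda_{\min}(\mathbf{P})}+\frac{n\sigma_h^2+q}{\sigma_j^2}\right)^{-1}>0 .$$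
   Context: Let $n\ge2$, $m\ge1$, $[n]=\{1,\dots,n\}$. At a fixed time step, $\mathbf{P}\in\mathbb{R}^{m\times m}$ is a symmetric positive definite matrix (the Kalman filter's predicted error covariance $\mathbf{P}_{k|k-1}$), $\mathbf{h}_1,\dots,\mathbf{h}_n\in\mathbb{R}^m$ are measurement (column) vectors, $\mathbf{H}\in\mathbb{R}^{n\times m}$ is the matrix with rows $\mathbf{h}_1^\top,\dots,\mathbf{h}_n^\top$, and $\sigma_1^2,\dots,\sigma_n^2>0$ are the noise variances of the sensors. For $S\subseteq[n]$, $$\mathbf{F}_S=\mathbf{P}^{-1}+\sum_{i\in S}\sigma_i^{-2}\mathbf{h}_i\mathbf{h}_i^\top .$$ $\lambda_{\max},\lambda_{\min}$ denote the largest and smallest eigenvalues. Element-wise curvature: for a monotone non-decreasing $f:2^{[n]}\to\mathbb{R}$ put $f_i(S)=f(S\cup\{i\})-f(S)$. For $1\le l\le n-1$, $$\mathcal{C}_l=\max_{(S,T,i)\in\mathcal{X}_l}\frac{f_i(T)}{f_i(S)},\qquad \mathcal{X}_l=\{(S,T,i): S\subset T\subset[n],\ i\in[n]\setminus T,\ |T\setminus S|=l\},$$ and $\mathcal{C}_{\max}=\max_{1\le l\le n-1}\mathcal{C}_l$. Convention: $0/0:=0$ (this occurs for the present $f$ only if $\mathbf{h}_i=\mathbf{0}$). *)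

(* Defs.v *)
From HB Require Import structures.
From mathcomp Require Import all_boot all_order all_algebra.
From mathcomp Require Import all_classical all_reals all_analysis.

Set Implicit Arguments.
Unset Strict Implicit.
Unset Printing Implicit Defensive.

Import Order.TTheory GRing.Theory Num.Theory.
Import numFieldTopology.Exports numFieldNormedType.Exports.

Local Open Scope classical_set_scope.
Local Open Scope ring_scope.

(* Every [sup] and [inf] below is meant for a finite nonempty set of reals, of
   which it is the maximum, resp. the minimum. *)

(* The spectrum of a real symmetric matrix of positive size is finite, nonempty
   and real, so that these are its extreme eigenvalues. *)
Definition lambda_max (R : realType) (m : nat) (A : 'M[R]_m) : R :=
  sup [set a : R | eigenvalue A a].

Definition lambda_min (R : realType) (m : nat) (A : 'M[R]_m) : R :=
  inf [set a : R | eigenvalue A a].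

Definition sym_posdef (R : realType) (m : nat) (A : 'M[R]_m) : Prop :=
  A^T = A /\ forall x : 'cV[R]_m, x != 0 -> 0 < (x^T *m A *m x) 0 0.

(* The library norm on matrices is the sup norm, hence the explicit sum. *)
Definition sqnorm2 (R : realType) (m : nat) (x : 'cV[R]_m) : R :=
  \sum_(a < m) x a 0 ^+ 2.

Definition marginal (R : realType) (n : nat) (f : {set 'I_n} -> R) (i : 'I_n)
    (S : {set 'I_n}) : R :=
  f (i |: S) - f S.

(* As x / 0 = 0 in a [fieldType], the convention 0 / 0 = 0 is built in. *)
Definition curvature (R : realType) (n : nat) (f : {set 'I_n} -> R) (l : nat)
    : R :=
  sup [set r : R | exists (S T : {set 'I_n}) (i : 'I_n),
         [/\ S \subset T, i \notin T, #|T :\: S| = l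
           & r = marginal f i T / marginal f i S]].

Definition curvature_max (R : realType) (n : nat) (f : {set 'I_n} -> R) : R :=
  sup [set curvature f l | l in [set l : nat | (1 <= l <= n.-1)%N]].

Section Sensors.
Variables (R : realType) (n m : nat).
Variables (P : 'M[R]_m) (sigma2 : 'I_n -> R) (h : 'I_n -> 'cV[R]_m).

Definition measurement_mx : 'M[R]_(n, m) := \matrix_(i, a) h i a 0.

Definition information_mx (S : {set 'I_n}) : 'M[R]_m :=
  invmx P + \sum_(i in S) (sigma2 i)^-1 *: (h i *m (h i)^T).

Definition trace_objective (S : {set 'I_n}) : R :=
  \tr (P - invmx (information_mx S)).

Definition spectral_condition (phi : R) : Prop :=
  lambda_max (measurement_mx^T *m measurement_mx) <=
  (phi^-1 - (lambda_min P)^-1) * inf (range sigma2).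

Definition curvature_bound (C phi : R) : Prop :=
  curvature_max trace_objective <=
  sup (range (fun j : 'I_n =>
    (lambda_max P ^+ 2 * (sigma2 j + lambda_max P * C)) /
    (phi ^+ 2 * (sigma2 j + phi * C)))).

End Sensors.

(* R^m with its Borel sigma-algebra. *)
Definition borel_cV (R : realType) (m : nat) :=
  g_sigma_algebraType (@open 'cV[R]_m).

Section RandomVectors.
Context (R : realType) (n m : nat) (d : measure_display).
Context (Omega : measurableType d) (Pr : probability Omega R).

Definition coord (X : Omega -> 'cV[R]_m) (a : 'I_m) : Omega -> R :=
  fun w => X w a 0.

(* Some of the [B j] may be the whole space, so the product rule for all
   subfamilies is included. *)
Definition independent_vectors (h : 'I_n -> {RV Pr >-> borel_cV R m}) : Prop :=
  forall B : 'I_n -> set (borel_cV R m), (forall j, measurable (B j)) ->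
    Pr (\bigcap_(j in [set: 'I_n]) (h j @^-1` B j)) =
    (\prod_(j < n) Pr (h j @^-1` B j))%E.

Definition identically_distributed (h : 'I_n -> {RV Pr >-> borel_cV R m})
    : Prop :=
  forall (i j : 'I_n) (B : set (borel_cV R m)), measurable B ->
    distribution Pr (h i) B = distribution Pr (h j) B.

Definition zero_mean (X : Omega -> 'cV[R]_m) : Prop :=
  forall a : 'I_m, ('E_Pr[coord X a] = 0)%E.

Definition has_covariance_mx (X : Omega -> 'cV[R]_m) (V : 'M[R]_m) : Prop :=
  forall a b : 'I_m, covariance Pr (coord X a) (coord X b) = (V a b)%:E.

End RandomVectors.

(* Main.v *)
(* Part (i): by Sherman-Morrison the marginal gain of sensor [i] at [S] is
   [|G h|^2 / (sigma^2 + h^T G h)] with [G] the inverse of [F_S], and the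
   spectral condition confines the eigenvalues of [G] to [phi, lambda_max P].

   Part (ii) is a matrix Bernstein inequality for [sum_j h_j h_j^T].  Because
   the summands have rank one, neither Lieb's theorem nor Golden-Thompson is
   needed: for [A] positive semidefinite and [|h|^2 <= C], expanding
   [tr (A + h h^T)^k] in words and applying Chebyshev's inequality
   [(h^T A^i h) (h^T A^j h) <= |h|^2 h^T A^(i+j) h] gives
     [C (tr (A + h h^T)^k - tr A^k) <= h^T (A + C)^k h - h^T A^k h],
   hence, for every truncation [e_N] of the exponential series,
     [C (tr e_N(t(A + h h^T)) - tr e_N(tA)) <= (exp(tC) - 1) h^T e_N(tA) h].
   If [h] is independent of [A] with second moment [v I], each summand thus
   multiplies the expected trace by at most [1 + v/C (exp(tC) - 1)], the moment
   generating function of [C] times a Bernoulli variable of mean [v/C], and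
   the scalar Bernstein estimate for that variable finishes the proof. *)

Require Import Defs.
From HB Require Import structures.
From mathcomp Require Import perm complex.
From mathcomp Require Import all_boot all_order all_algebra.
From mathcomp Require Import all_classical all_reals all_analysis.
From mathcomp Require Import measurable_realfun ring lra.

Import Order.TTheory GRing.Theory Num.Theory.
Import numFieldTopology.Exports numFieldNormedType.Exports.

Local Open Scope classical_set_scope.
Local Open Scope ring_scope.

Set Implicit Arguments.
Unset Strict Implicit.
Unset Printing Implicit Defensive.

(** * Quadratic forms and the spectral theorem for real symmetric matrices *)

Definition qform (R : nzRingType) (m : nat) (A : 'M[R]_m) (x : 'cV[R]_m) : R :=
  (x^T *m A *m x) 0 0.

Lemma exp_similar_diag (F : fieldType) (m : nat) (U : 'M[F]_m) (d : 'rV[F]_m) k :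
  U \in unitmx ->
  (invmx U *m diag_mx d *m U) ^+ k =
  invmx U *m diag_mx (\row_i d 0 i ^+ k) *m U.
Proof.
move=> Uu; elim: k => [|k IH].
  rewrite expr0; have -> : \row_i d 0 i ^+ 0 = const_mx 1.
    by apply/rowP => i; rewrite !mxE expr0.
  by rewrite diag_const_mx mulmx1 mulVmx.
rewrite exprS IH -mulmxE !mulmxA mulmxK //.
rewrite -[_ *m diag_mx d *m _]mulmxA mulmx_diag; congr (_ *m diag_mx _ *m _).
by apply/rowP => i; rewrite !mxE -exprS.
Qed.

Lemma map_exp_mx (S T : nzRingType) (f : {rmorphism S -> T}) (m : nat)
    (A : 'M[S]_m) k : map_mx f (A ^+ k) = (map_mx f A) ^+ k.
Proof.
elim: k => [|k IH]; first by rewrite !expr0 map_mx1.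
by rewrite !exprS -!mulmxE map_mxM IH.
Qed.

(** Diagonalise over the complex numbers: [w x i] is the squared modulus of the [i]-th coordinate of
    [x] in a unitary eigenbasis. Forms and traces of powers thus become scalar sums, and later
    spectral arguments only handle these nonnegative weights. *)
Lemma spectral_expansion (R : realType) (m : nat) (A : 'M[R]_m) : A^T = A ->
  exists (l : 'I_m -> R) (w : 'cV[R]_m -> 'I_m -> R),
    [/\ forall i, eigenvalue A (l i),
        forall x i, 0 <= w x i,
        forall k x, qform (A ^+ k) x = \sum_i l i ^+ k * w x i &
        forall k, \tr (A ^+ k) = \sum_i l i ^+ k].
Proof.
move=> Asym.
pose toC : {rmorphism R -> R[i]} := complex.real_complex R.
pose B := map_mx toC A.
have Breal : B \is a mxOver Num.real.
  by apply/mxOverP => i j; rewrite mxE complex.complex_real.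
have Bherm : B \is hermsymmx.
  apply: realsym_hermsym => //; apply/is_hermitianmxP.
  by rewrite expr0 scale1r map_mx_id // /B map_trmx Asym.
(* A real symmetric matrix is hermitian over [R[i]], hence unitarily diagonalisable with real
   eigenvalues. *)
have [U [d [Uu Ui dreal BE]]] : exists (U : 'M[R[i]]_m) (d : 'rV[R[i]]_m),
    [/\ U \in unitmx, invmx U = (map_mx Num.conj U^T), d \is a mxOver Num.real &
        B = invmx U *m diag_mx d *m U].
  exists (spectralmx B), (spectral_diag B); split.
  - exact: spectral_unit.
  - exact/invmx_unitary/spectral_unitarymx.
  - exact: hermitian_spectral_diag_real.
  - exact/orthomx_spectralP/hermitian_normalmx.
pose l i := complex.Re (d 0 i).
have dl i : d 0 i = toC (l i).
  by rewrite /l; have /mxOverP/(_ 0 i)/complex.RRe_real := dreal.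
have Bk k : B ^+ k = invmx U *m diag_mx (\row_i toC (l i) ^+ k) *m U.
  have -> : \row_i toC (l i) ^+ k = \row_i d 0 i ^+ k.
    by apply/rowP => i; rewrite !mxE dl.
  by rewrite BE; exact: exp_similar_diag.
pose w (x : 'cV[R]_m) (i : 'I_m) : R := let z := (U *m map_mx toC x) i 0 in
  complex.Re z ^+ 2 + complex.Im z ^+ 2.
exists l, w; split.
(* Row [i] of [U] is a left eigenvector of [B]; its eigenvalue descends to [A] as a root of the
   characteristic polynomial, which commutes with [toC]. *)
- move=> i; rewrite eigenvalue_root_char -(fmorph_root toC) map_char_poly -/B.
  rewrite -eigenvalue_root_char -dl; apply/eigenvalueP; exists (row i U); last first.
    apply/eqP => /(congr1 (mulmx^~ (invmx U))); rewrite -row_mul mulmxV //.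
    by rewrite mul0mx => /rowP/(_ i)/eqP; rewrite !mxE eqxx oner_eq0.
  rewrite {1}BE -row_mul !mulmxA mulmxV // mul1mx.
  by rewrite mul_diag_mx; apply/rowP => j; rewrite !mxE.
- by move=> x i; rewrite addr_ge0 // sqr_ge0.
- move=> k x; apply: (@complex.complexI R); rewrite -[LHS]/(toC _) -[RHS]/(toC _).
  have -> : toC (qform (A ^+ k) x) = ((map_mx toC x)^T *m B ^+ k *m map_mx toC x) 0 0.
    by rewrite -map_exp_mx map_trmx -!map_mxM [RHS]mxE.
  rewrite Bk !mulmxA Ui -(mulmxA _ U).
  set z := U *m map_mx toC x.
  have -> : (map_mx toC x)^T *m map_mx Num.conj U^T = map_mx Num.conj z^T.
    rewrite /z trmx_mul map_mxM; congr (_ *m _); apply/matrixP => i j.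
    by rewrite !mxE; apply/esym/CrealP; rewrite complex.complex_real.
  rewrite mul_mx_diag mxE rmorph_sum; apply: eq_bigr => i _.
  have wE : toC (w x i) = z i 0 * (z i 0)^*.
    by rewrite -normCK -complex.add_Re2_Im2.
  rewrite rmorphM rmorphXn wE 2!mxE [z^T 0 i]mxE.
  by rewrite [X in _ * X * _]mxE mulrAC mulrC [_^* * _]mulrC.
- move=> k; apply: (@complex.complexI R); rewrite -[LHS]/(toC _) -[RHS]/(toC _).
  rewrite -trace_map_mx map_exp_mx -/B Bk mxtrace_mulC mulmxA mulmxV // mul1mx.
  rewrite mxtrace_diag rmorph_sum; apply: eq_bigr => i _.
  by rewrite mxE rmorphXn.
Qed.

Definition psd (R : numDomainType) (m : nat) (A : 'M[R]_m) : Prop :=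
  forall x : 'cV[R]_m, 0 <= qform A x.

Lemma sqnorm2E (R : realType) (m : nat) (x : 'cV[R]_m) :
  sqnorm2 x = (x^T *m x) 0 0.
Proof.
by rewrite mxE; apply: eq_bigr => i _; rewrite !mxE expr2.
Qed.

Lemma qform1 (R : realType) (m : nat) (x : 'cV[R]_m) : qform 1 x = sqnorm2 x.
Proof. by rewrite /qform mulmx1 sqnorm2E. Qed.

Lemma sqnorm2_ge0 (R : realType) (m : nat) (x : 'cV[R]_m) : 0 <= sqnorm2 x.
Proof. by apply: sumr_ge0 => i _; exact: sqr_ge0. Qed.

Lemma sqnorm2_gt0 (R : realType) (m : nat) (x : 'cV[R]_m) :
  (0 < sqnorm2 x) = (x != 0).
Proof.
rewrite lt0r sqnorm2_ge0 andbT; congr (~~ _); apply/eqP/eqP => [|->]; last first.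
  by apply: big1 => i _; rewrite mxE expr0n.
move/eqP; rewrite psumr_eq0 => [/allP x0|i _]; last exact: sqr_ge0.
apply/colP => i; rewrite mxE; apply/eqP.
by rewrite -sqrf_eq0; apply: x0; rewrite mem_index_enum.
Qed.

Lemma trmx_exp (R : comNzRingType) (m : nat) (A : 'M[R]_m) k :
  A^T = A -> (A ^+ k)^T = A ^+ k.
Proof.
move=> As; elim: k => [|k IH]; first by rewrite expr0 trmx1.
by rewrite exprS -mulmxE trmx_mul IH As mulmxE -exprSr exprS.
Qed.

Lemma eigenvalue_qform (R : realType) (m : nat) (A : 'M[R]_m) a :
  eigenvalue A a ->
  exists x : 'cV[R]_m, 0 < sqnorm2 x /\ qform A x = a * sqnorm2 x.
Proof.
move=> /eigenvalueP[v vA v0]; exists v^T; split.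
  by rewrite sqnorm2_gt0 trmx_eq0.
by rewrite /qform trmxK vA sqnorm2E trmxK -scalemxAl mxE.
Qed.

(** * Extreme eigenvalues and Rayleigh bounds *)

Section Symmetric.
Variables (R : realType) (m : nat) (A : 'M[R]_m).
Hypothesis Asym : A^T = A.

(** At exponent 0 the expansion says that the weights sum to |x|^2, so the form is |x|^2 times a
    weighted mean of eigenvalues. *)
Lemma eigenvalues_sandwich (a b : R) :
  (forall c, eigenvalue A c -> a <= c <= b) ->
  forall x, a * sqnorm2 x <= qform A x <= b * sqnorm2 x.
Proof.
move=> ab x; have [l [w [el w0 qE _]]] := spectral_expansion Asym.
have -> : sqnorm2 x = \sum_i w x i.
  by rewrite -qform1 -(expr0 A) qE; apply: eq_bigr => i _; rewrite expr0 mul1r.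
rewrite -[A]expr1 qE !mulr_sumr; apply/andP; split; apply: ler_sum => i _;
by rewrite expr1 ler_wpM2r //; have /andP[] := ab _ (el i).
Qed.

Lemma eigenvalues_bounded : exists b : R, forall c, eigenvalue A c -> `|c| <= b.
Proof.
have [l [w [el w0 qE _]]] := spectral_expansion Asym.
exists (\sum_i `|l i|) => c /eigenvalue_qform[x [x0 qx]].
rewrite -(ler_pM2r x0) -[sqnorm2 x in leLHS]gtr0_norm // -normrM -qx.
rewrite -[A]expr1 qE; apply: le_trans (ler_norm_sum _ _ _) _.
have -> : sqnorm2 x = \sum_i w x i.
  by rewrite -qform1 -(expr0 A) qE; apply: eq_bigr => i _; rewrite expr0 mul1r.
rewrite mulr_suml; apply: ler_sum => i _; rewrite expr1 normrM.
rewrite ler_wpM2l // ger0_norm // (bigD1 i) //= lerDl.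
by apply: sumr_ge0.
Qed.

Hypothesis m_gt0 : (0 < m)%N.

Lemma eigenvalue_exists : exists c, eigenvalue A c.
Proof.
have [l [w [el _ _ _]]] := spectral_expansion Asym.
by exists (l (Ordinal m_gt0)).
Qed.

(** The Rayleigh characterisation trades the [sup] over the spectrum for inequalities between forms.
    It rests on the spectrum being bounded and nonempty, since [sup] is meaningful only then. *)
Lemma lambda_max_leP (b : R) :
  lambda_max A <= b <-> forall x, qform A x <= b * sqnorm2 x.
Proof.
have [B Bb] := eigenvalues_bounded; have [c0 ec0] := eigenvalue_exists.
split=> [lb x|qb].
  suff /eigenvalues_sandwich/(_ x)/andP[] :
      forall c, eigenvalue A c -> - B <= c <= b by [].
  move=> c ec; apply/andP; split.
    by have := Bb _ ec; rewrite ler_norml => /andP[].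
  apply: le_trans lb; apply: ub_le_sup => //; exists B => d ed.
  by apply: le_trans (Bb _ ed); exact: ler_norm.
apply: ge_sup; first by exists c0.
move=> c /eigenvalue_qform[x [x0 qx]].
by rewrite -(ler_pM2r x0) -qx.
Qed.

Lemma lambda_min_geP (a : R) :
  a <= lambda_min A <-> forall x, a * sqnorm2 x <= qform A x.
Proof.
have [B Bb] := eigenvalues_bounded; have [c0 ec0] := eigenvalue_exists.
split=> [la x|qa].
  suff /eigenvalues_sandwich/(_ x)/andP[] :
      forall c, eigenvalue A c -> a <= c <= B by [].
  move=> c ec; apply/andP; split; last exact: le_trans (ler_norm _) (Bb _ ec).
  apply: le_trans la _; apply: ge_inf => //; exists (- B) => d ed.
  by have := Bb _ ed; rewrite ler_norml => /andP[].
apply: lb_le_inf; first by exists c0.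
move=> c /eigenvalue_qform[x [x0 qx]].
by rewrite -(ler_pM2r x0) -qx.
Qed.

End Symmetric.

(** * Powers of positive semidefinite matrices *)

Section PSD.
Variables (R : realType) (m : nat) (A : 'M[R]_m).
Hypotheses (Asym : A^T = A) (Apsd : psd A).

Lemma psd_eigenvalue_ge0 c : eigenvalue A c -> 0 <= c.
Proof.
move=> /eigenvalue_qform[x [x0 qx]].
by rewrite -(pmulr_lge0 _ x0) -qx.
Qed.

Lemma psd_exp k : psd (A ^+ k).
Proof.
move=> x; have [l [w [el w0 qE _]]] := spectral_expansion Asym.
rewrite qE; apply: sumr_ge0 => i _; rewrite mulr_ge0 // exprn_ge0 //.
exact: psd_eigenvalue_ge0.
Qed.

Lemma trace_exp_ge0 k : 0 <= \tr (A ^+ k).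
Proof.
have [l [w [el w0 _ tE]]] := spectral_expansion Asym.
rewrite tE; apply: sumr_ge0 => i _; rewrite exprn_ge0 //.
exact: psd_eigenvalue_ge0.
Qed.

(** Some eigenvalue is at least [s], for otherwise the Rayleigh bound would give
    [lambda_max A <= s]; the other eigenvalues contribute nonnegative powers. *)
Lemma trace_exp_ge (s : R) k : (0 < m)%N -> 0 <= s -> s < lambda_max A ->
  s ^+ k <= \tr (A ^+ k).
Proof.
move=> m0 s0 sl; have [l [w [el w0 qE tE]]] := spectral_expansion Asym.
have l0 i : 0 <= l i by exact: psd_eigenvalue_ge0.
have [i si] : exists i, s <= l i.
  apply: contrapT => /forallNP ls; suff : lambda_max A <= s by rewrite leNgt sl.
  apply/(lambda_max_leP Asym m0) => x; rewrite -qform1 -(expr0 A) -[A in leLHS]expr1.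
  rewrite !qE mulr_sumr; apply: ler_sum => i _.
  by rewrite expr1 expr0 mul1r ler_wpM2r // ltW // ltNge; apply/negP/ls.
rewrite tE (bigD1 i) //=; apply: ler_wpDr; last by rewrite lerXn2r // nnegrE.
by apply: sumr_ge0 => j _; rewrite exprn_ge0.
Qed.

(* Chebyshev's sum inequality for the spectral measure of [x]: [t ^ i] and
   [t ^ j] are both nondecreasing on the nonnegative spectrum. *)
Lemma qform_exp_chebyshev (x : 'cV[R]_m) i j :
  qform (A ^+ i) x * qform (A ^+ j) x <= qform 1 x * qform (A ^+ (i + j)) x.
Proof.
have [l [w [el w0 qE _]]] := spectral_expansion Asym.
have l0 a : 0 <= l a by exact: psd_eigenvalue_ge0.
rewrite -(expr0 A) !qE -subr_ge0.
have dbl (f g : 'I_m -> R) : (\sum_a f a * w x a) * (\sum_b g b * w x b) =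
    \sum_a \sum_b f a * g b * (w x a * w x b).
  rewrite mulr_suml; apply: eq_bigr => a _; rewrite mulr_sumr.
  by apply: eq_bigr => b _; rewrite mulrACA.
(* Double the difference and exchange [a] and [b] in one copy: each summand then factors as a
   product of two differences of the same sign, times weights. *)
rewrite !dbl -(@pmulr_rge0 _ 2%:R) // mulr_natl mulr2n.
rewrite {1}[X in X - _]exchange_big {1}[X in _ - X]exchange_big /=.
rewrite -!sumrB -big_split; apply: sumr_ge0 => a _ /=.
rewrite -!sumrB -big_split; apply: sumr_ge0 => b _ /=.
have -> : l b ^+ 0 * l a ^+ (i + j) * (w x b * w x a)
    - l b ^+ i * l a ^+ j * (w x b * w x a)
    + (l a ^+ 0 * l b ^+ (i + j) * (w x a * w x b)
    - l a ^+ i * l b ^+ j * (w x a * w x b)) =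
    (l a ^+ i - l b ^+ i) * (l a ^+ j - l b ^+ j) * (w x a * w x b).
  by rewrite !expr0 !exprD; ring.
apply: mulr_ge0; last exact: mulr_ge0.
have [ab|/ltW ab] := leP (l a) (l b).
  by rewrite mulr_le0 // subr_le0 lerXn2r // nnegrE.
by rewrite mulr_ge0 // subr_ge0 lerXn2r // nnegrE.
Qed.

End PSD.

Section QformLinear.
Variables (R : comNzRingType) (m : nat) (x : 'cV[R]_m).

Lemma qformD (A B : 'M[R]_m) : qform (A + B) x = qform A x + qform B x.
Proof. by rewrite /qform mulmxDr mulmxDl mxE. Qed.

Lemma qformZ c (A : 'M[R]_m) : qform (c *: A) x = c * qform A x.
Proof. by rewrite /qform -scalemxAr -scalemxAl mxE. Qed.

Lemma qform0 : qform 0 x = 0 :> R.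
Proof. by rewrite /qform mulmx0 mul0mx mxE. Qed.

Lemma qform_sum (I : Type) (r : seq I) (Q : pred I) (F : I -> 'M[R]_m) :
  qform (\sum_(i <- r | Q i) F i) x = \sum_(i <- r | Q i) qform (F i) x.
Proof. by elim/big_ind2: _ => [|? ? ? ? <- <-|//]; rewrite ?qform0 ?qformD. Qed.

Lemma qform_tr (A : 'M[R]_m) : qform A^T x = qform A x.
Proof.
by rewrite /qform -[in LHS]mulmxA -[in LHS](trmxK x) -!trmx_mul mxE trmxK.
Qed.

End QformLinear.

(** * Traces of powers under a rank-one update *)

Section RankOneUpdate.
Variables (R : realType) (m : nat) (A : 'M[R]_m) (h : 'cV[R]_m) (C : R).
Hypotheses (Asym : A^T = A) (Apsd : psd A) (hC : sqnorm2 h <= C).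

Let X := A + h *m h^T.
Let b j i := qform (A ^+ j * X ^+ i) h.
Let c j i := qform (A ^+ j * (A + C%:M) ^+ i) h.

(** The index [j] makes the recursion close: of the factor [X] peeled off, the summand [A] joins
    [A ^+ j], while h h^T splits the form into a product of two forms. *)
Let bS j i : b j i.+1 = b j.+1 i + qform (A ^+ j) h * b 0 i.
Proof.
rewrite /b exprS mulrA {2}/X mulrDr mulrDl -exprSr qformD; congr (_ + _).
by rewrite expr0 mul1r /qform -!mulmxE !mulmxA -2!mulmxA [LHS]mxE big_ord1 !mulmxA.
Qed.

Let cS j i : c j i.+1 = c j.+1 i + C * c j i.
Proof.
rewrite /c exprS mulrA mulrDr mulrDl -exprSr qformD -qformZ; congr (_ + qform _ _).
by rewrite -!mulmxE mul_mx_scalar -scalemxAl.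
Qed.

Let C_ge0 : 0 <= C. Proof. exact: le_trans (sqnorm2_ge0 h) hC. Qed.

Let c_ge0 j i : 0 <= c j i.
Proof.
elim: i j => [|i IH] j; first by rewrite /c expr0 mulr1; exact: psd_exp.
by rewrite cS addr_ge0 // mulr_ge0.
Qed.

(** At [i = 0] this is Chebyshev's inequality with |h|^2 <= C; both sides then obey the same linear
    recurrence [cS]. *)
Let c_chebyshev i j l : qform (A ^+ j) h * c l i <= C * c (j + l) i.
Proof.
elim: i j l => [|i IH] j l.
  rewrite /c !expr0 !mulr1; apply: le_trans (qform_exp_chebyshev Asym Apsd _ _ _) _.
  by rewrite qform1 ler_wpM2r //; exact: psd_exp.
rewrite !cS !mulrDr lerD //; first by rewrite -addnS.
by rewrite mulrCA ler_wpM2l.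
Qed.

Let b_ge0 j i : 0 <= b j i.
Proof.
elim: i j => [|i IH] j; first by rewrite /b expr0 mulr1; exact: psd_exp.
by rewrite bS addr_ge0 // mulr_ge0 //; exact: psd_exp.
Qed.

(** Compare the two recurrences term by term: by [c_chebyshev], the product term of [bS] is at most
    the term [C * c j i] of [cS]. *)
Let b_le_c j i : b j i <= c j i.
Proof.
elim: i j => [|i IH] j; first by rewrite /b /c !expr0.
rewrite bS cS lerD //.
rewrite -[in leRHS](addn0 j); apply: le_trans (c_chebyshev i j 0).
by rewrite ler_wpM2l //; exact: psd_exp.
Qed.

Lemma trace_rank_one_update k :
  C * (\tr (X ^+ k) - \tr (A ^+ k)) <=
  qform ((A + C%:M) ^+ k) h - qform (A ^+ k) h.
Proof.
(* Peeling [X] off [X ^+ k] produces powers of [A] in front, so the induction carries a prefix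
   [A ^+ l]. The rank-one part of each peeled factor contributes [b l k], at most [c l k]. *)
suff H l : C * (\tr (A ^+ l * X ^+ k) - \tr (A ^+ (l + k))) <=
    c l k - qform (A ^+ (l + k)) h.
  by have := H 0; rewrite /c expr0 !mul1r.
elim: k l => [|k IH] l.
  by rewrite /c !expr0 !mulr1 addn0 !subrr mulr0.
have -> : \tr (A ^+ l * X ^+ k.+1) = \tr (A ^+ l.+1 * X ^+ k) + b l k.
  rewrite exprS mulrA {1}/X mulrDr mulrDl -exprSr linearD /=; congr (_ + _).
  have Xsym : X^T = X by rewrite /X linearD /= Asym trmx_mul trmxK.
  rewrite -!mulmxE mulmxA -mulmxA mxtrace_mulC.
  rewrite /mxtrace big_ord1 /b -qform_tr -mulmxE trmx_mul !trmx_exp //.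
  by rewrite /qform !mulmxA.
rewrite cS addnS -addSn -addrA [b l k + _]addrC addrA mulrDr.
rewrite [_ + C * c l k]addrC -addrA [leRHS]addrC lerD //.
by rewrite ler_wpM2l.
Qed.

End RankOneUpdate.

(** * Truncated exponential series *)

Lemma triangular_sum_le (R : numDomainType) (u y : nat -> R) N :
  (forall k, 0 <= u k) -> (forall k, 0 <= y k) ->
  \sum_(k < N) \sum_(r < k.+1) u r * y (k - r)%N <=
  (\sum_(r < N) u r) * \sum_(k < N) y k.
Proof.
move=> u0 y0; rewrite mulr_suml.
(* The pairs (r, k - r) with k < N form a triangle inside the square of side [N]; the terms left out
   are nonnegative. *)
have -> : \sum_(k < N) \sum_(r < k.+1) u r * y (k - r)%N =
    \sum_(k < N) \sum_(r < N | (r <= k)%N) u r * y (k - r)%N.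
  apply: eq_bigr => k _.
  rewrite (big_ord_widen_cond N xpredT (fun r => u r * y (k - r)%N) (ltn_ord k)) /=.
  exact: eq_bigl.
rewrite (exchange_big_dep xpredT) //=; apply: ler_sum => r _.
rewrite -mulr_sumr ler_wpM2l //.
rewrite -(big_mkord (fun k => (r <= k)%N) (fun k => y (k - r)%N)).
rewrite -(big_mkord xpredT y) (big_cat_nat (leq0n r) (ltnW (ltn_ord r))) //=.
rewrite [X in X + _]big1_seq ?add0r; last first.
  by move=> k /andP[rk]; rewrite mem_index_iota ltnNge rk.
have -> : \sum_(r <= k < N | (r <= k)%N) y (k - r)%N = \sum_(0 <= k < N - r) y k.
  rewrite -{1}[nat_of_ord r]add0n big_addn; apply: eq_big => k.
    by rewrite leq_addl.
  by rewrite addnK.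
by rewrite [leRHS](big_cat_nat (leq0n _) (leq_subr r N)) //= lerDl sumr_ge0.
Qed.

Lemma series_exp_coeff_le (R : realType) (x : R) N : 0 <= x ->
  \sum_(k < N) x ^+ k / k`!%:R <= expR x.
Proof.
move=> x0.
have := @nondecreasing_cvgn_le _ (series (exp_coeff x)) _ (is_cvg_series_exp_coeff x) N.
rewrite /series /= big_mkord; apply.
apply/nondecreasing_seqP => n; rewrite [leRHS]big_nat_recr //= lerDl.
exact: exp_coeff_ge0.
Qed.

(** A polynomial in the entries of [A], so measurability, boundedness and expectations need only
    finite sums. *)
Definition expmx_trunc (R : realType) (m : nat) (t : R) (N : nat) (A : 'M[R]_m) :
    'M[R]_m :=
  \sum_(k < N) (t ^+ k / k`!%:R) *: A ^+ k.

(* A rank-one substitute for the Golden-Thompson inequality. *)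
Lemma trace_expmx_trunc_update (R : realType) (m : nat) (A : 'M[R]_m)
    (h : 'cV[R]_m) (C t : R) N :
  A^T = A -> psd A -> sqnorm2 h <= C -> 0 <= t ->
  C * (\tr (expmx_trunc t N (A + h *m h^T)) - \tr (expmx_trunc t N A)) <=
  (expR (t * C) - 1) * qform (expmx_trunc t N A) h.
Proof.
move=> As Ap hC t0.
have C0 : 0 <= C by exact: le_trans (sqnorm2_ge0 h) hC.
have a0 k : 0 <= qform (A ^+ k) h by exact: psd_exp.
have trE (B : 'M[R]_m) : \tr (expmx_trunc t N B) =
    \sum_(k < N) t ^+ k / k`!%:R * \tr (B ^+ k).
  by rewrite linear_sum; apply: eq_bigr => k _; rewrite linearZ.
have qE (B : 'M[R]_m) : qform (expmx_trunc t N B) h =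
    \sum_(k < N) t ^+ k / k`!%:R * qform (B ^+ k) h.
  by rewrite qform_sum; apply: eq_bigr => k _; rewrite qformZ.
have w0 k : 0 <= t ^+ k / k`!%:R by rewrite divr_ge0 ?exprn_ge0.
apply: (@le_trans _ _
  (qform (expmx_trunc t N (A + C%:M)) h - qform (expmx_trunc t N A) h)).
  rewrite !trE !qE -!sumrB mulr_sumr; apply: ler_sum => k _.
  by rewrite -!mulrBr mulrCA ler_wpM2l // trace_rank_one_update.
rewrite mulrBl mul1r lerB // !qE.
pose u r : R := (t * C) ^+ r / r`!%:R.
pose y k : R := t ^+ k / k`!%:R * qform (A ^+ k) h.
(* Since [C%:M] commutes with [A], the binomial theorem turns the series at A + C into the
   triangular part of the product of the series of exp(tC) and the series at [A]. *)
apply: (@le_trans _ _ (\sum_(k < N) \sum_(r < k.+1) u r * y (k - r)%N)).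
  apply: ler_sum => k _; rewrite exprDn_comm; last first.
    by rewrite /GRing.comm -!mulmxE mul_mx_scalar mul_scalar_mx.
  rewrite qform_sum mulr_sumr; apply: ler_sum => r _.
  rewrite -[X in qform X h]scaler_nat qformZ.
  have -> : (C%:M : 'M[R]_m) ^+ r = (C ^+ r)%:M.
    elim: (nat_of_ord r) => [|s IH]; first by rewrite !expr0.
    by rewrite !exprS IH -mulmxE -scalar_mxM.
  rewrite -mulmxE mul_mx_scalar qformZ /u /y.
  have rk : (r <= k)%N by rewrite -ltnS.
  rewrite -(bin_fact rk) !natrM -{1}(subnK rk) exprD exprMn.
  rewrite le_eqVlt; apply/orP; left; apply/eqP.
  have f0 s : (s`!%:R : R) != 0 by rewrite pnatr_eq0 -lt0n fact_gt0.
  have b0 : ('C(k, r)%:R : R) != 0 by rewrite pnatr_eq0 -lt0n bin_gt0.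
  by field; rewrite !f0 b0.
apply: le_trans (triangular_sum_le _ _ _) _.
- by move=> r; rewrite divr_ge0 ?exprn_ge0 // mulr_ge0.
- by move=> k; rewrite mulr_ge0.
apply: ler_wpM2r; first by rewrite sumr_ge0 // => k _; rewrite mulr_ge0.
by apply: series_exp_coeff_le; rewrite mulr_ge0.
Qed.

(** * The scalar Bernstein estimate *)

Lemma expR_le_of_partial_sums (R : realType) (x K : R) :
  (forall N, \sum_(k < N) x ^+ k / k`!%:R <= K) -> expR x <= K.
Proof.
move=> le_K; apply: limr_le; first exact: is_cvg_series_exp_coeff.
by exists 0%N => // N _; rewrite /series /= big_mkord.
Qed.

(** Since (j + 2)! >= 2 * 3^j, the series beyond its linear part is dominated by a geometric one of
    ratio x / 3. *)
Lemma expR_le_bernstein (R : realType) (x : R) : 0 <= x -> x < 3 ->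
  expR x <= 1 + x + x ^+ 2 / 2 / (1 - x / 3).
Proof.
move=> x0 x3.
have fact_ge j : 2 * 3 ^+ j <= (j.+2`!%:R : R).
  elim: j => [|j IH]; first by rewrite expr0 mulr1.
  rewrite factS natrM exprS mulrCA ler_pM ?ler_nat // mulr_ge0 // exprn_ge0 //.
have part N : \sum_(k < N.+2) x ^+ k / k`!%:R <=
    1 + x + x ^+ 2 / 2 * \sum_(j < N) (x / 3) ^+ j.
  rewrite 2!big_ord_recl /= expr0 expr1 !divr1 addrA lerD2l mulr_sumr.
  apply: ler_sum => j _; rewrite /bump /= !add1n expr_div_n mulf_div.
  rewrite -exprD add2n ler_wpM2l ?exprn_ge0 // lef_pV2 ?posrE ?mulr_gt0 //.
apply: expR_le_of_partial_sums => N.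
apply: (@le_trans _ _ (\sum_(k < N.+2) x ^+ k / k`!%:R)).
  by rewrite 2!big_ord_recr /= -addrA lerDl addr_ge0 // divr_ge0 // exprn_ge0.
apply: le_trans (part N) _; rewrite lerD2l ler_wpM2l ?divr_ge0 ?sqr_ge0 //.
have d0 : 0 < 1 - x / 3 by lra.
rewrite -[leRHS]div1r ler_pdivlMr // mulrC -opprB mulNr -subrX1 opprB gerBl.
by rewrite exprn_ge0 // divr_ge0.
Qed.

(** Invert exp(y) >= 1 + y + y^2/2 and use (1 - y + y^2/2)(1 + y + y^2/2) = 1 + y^4/4 >= 1. *)
Lemma expRN_le (R : realType) (y : R) : 0 <= y ->
  expR (- y) <= 1 - y + y ^+ 2 / 2.
Proof.
move=> y0; rewrite expRN.
have e2 : 1 + y + y ^+ 2 / 2 <= expR y.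
  apply: le_trans (series_exp_coeff_le 3 y0).
  by rewrite !big_ord_recl big_ord0 /= /bump /= expr0 expr1 !divr1 addr0 addrA.
have p0 : 0 < 1 + y + y ^+ 2 / 2 by have := sqr_ge0 y; lra.
apply: (@le_trans _ _ (1 + y + y ^+ 2 / 2)^-1).
  by rewrite lef_pV2 ?posrE // expR_gt0.
rewrite -[leLHS]div1r ler_pdivrMr //.
have -> : (1 - y + y ^+ 2 / 2) * (1 + y + y ^+ 2 / 2) = 1 + y ^+ 4 / 4 by field.
by rewrite lerDl divr_ge0 // exprn_ge0.
Qed.

(* The left-hand side is the moment generating function of [C] times a
   Bernoulli variable with mean [v]; its variance is [v * (C - v)] and it
   exceeds its mean by at most [C - v]. *)
Lemma bernoulli_mgf_le (R : realType) (v C t : R) :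
  0 <= v -> v < C -> 0 <= t -> t * (C - v) < 3 ->
  1 + v / C * (expR (t * C) - 1) <=
  expR (t * v + t ^+ 2 * (v * (C - v)) / 2 / (1 - t * (C - v) / 3)).
Proof.
move=> v0 vC t0 tL; have C0 : 0 < C by lra.
set L := C - v in tL *; have L0 : 0 < L by rewrite /L; lra.
set K := (1 - t * L / 3)^-1.
have K1 : 1 <= K by rewrite /K invf_ge1; have := mulr_ge0 t0 (ltW L0); lra.
(* Centre the variable: its deviation from the mean is -v with probability L / C and L with
   probability v / C. *)
have -> : 1 + v / C * (expR (t * C) - 1) =
    expR (t * v) * (L / C * expR (- (t * v)) + v / C * expR (t * L)).
  have e1 : expR (t * v) * expR (- (t * v)) = 1 by rewrite -expRD subrr expR0.
  have e2 : expR (t * v) * expR (t * L) = expR (t * C).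
    by rewrite -expRD; congr expR; rewrite /L; ring.
  rewrite [RHS]mulrDr [_ * (L / C * _)]mulrCA e1 [_ * (v / C * _)]mulrCA e2.
  by rewrite /L; field; rewrite gt_eqF.
rewrite expRD ler_wpM2l ?expR_ge0 //; apply: le_trans (expR_ge1Dx _).
(* As [K >= 1], it may also multiply the quadratic term of the lower deviation. The linear terms
   then cancel and the quadratic ones add up to t^2 v L K / 2. *)
apply: (@le_trans _ _ (L / C * (1 - t * v + (t * v) ^+ 2 / 2 * K) +
    v / C * (1 + t * L + (t * L) ^+ 2 / 2 * K))).
  apply: lerD; rewrite ler_wpM2l ?divr_ge0 //; try exact: ltW.
    apply: le_trans (expRN_le _) _; first exact: mulr_ge0.
    by rewrite lerD2l ler_peMr // divr_ge0 // sqr_ge0.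
  by apply: expR_le_bernstein => //; rewrite mulr_ge0 // ltW.
rewrite le_eqVlt; apply/orP; left; apply/eqP.
have -> : C = v + L by rewrite /L; ring.
by rewrite -/K; field; rewrite gt_eqF // /L; lra.
Qed.

(** With this [t], 1 - t (C - v) / 3 equals n v / (n v + q / 3), and for v > 0 the [n]-th power of
    the bound in [bernoulli_mgf_le] is exactly the right-hand side. *)
Lemma bernstein_exponent (R : realType) (n : nat) (v C q : R)
    (t := q / ((C - v) * (n%:R * v + q / 3))) :
  (0 < n)%N -> 0 <= v -> v < C -> 0 < q ->
  (1 + v / C * (expR (t * C) - 1)) ^+ n <=
  expR (t * (n%:R * v + q)) *
  expR ((- q ^+ 2 / 2) / ((C - v) * (n%:R * v + q / 3))).
Proof.
move=> n0 v0 vC q0.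
have L0 : 0 < C - v by lra.
have nv0 : 0 <= n%:R * v by rewrite mulr_ge0.
have d0 : 0 < n%:R * v + q / 3 by lra.
have D0 : 0 < (C - v) * (n%:R * v + q / 3) by rewrite mulr_gt0.
have t0 : 0 <= t by rewrite divr_ge0 // ltW.
rewrite -expRD.
(* At v = 0 one has t (C - v) = 3, just outside the range of [bernoulli_mgf_le]; but then the
   left-hand side is 1. *)
have [v_eq0|v_neq0] := eqVneq v 0.
  rewrite {1}v_eq0 mul0r mul0r addr0 expr1n -[leLHS]expR0 ler_expR.
  have -> : t * (n%:R * v + q) + (- q ^+ 2 / 2) / ((C - v) * (n%:R * v + q / 3)) =
      q ^+ 2 / 2 / ((C - v) * (n%:R * v + q / 3)) + t * (n%:R * v).
    by rewrite /t; field; rewrite !gt_eqF //; lra.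
  apply: addr_ge0; last exact: mulr_ge0.
  by rewrite !divr_ge0 ?sqr_ge0 // ltW.
have nvp : 0 < n%:R * v by rewrite mulr_gt0 ?ltr0n // lt0r v_neq0.
have tL : t * (C - v) = q / (n%:R * v + q / 3).
  by rewrite /t; field; rewrite !gt_eqF //; lra.
have tL3 : t * (C - v) < 3 by rewrite tL ltr_pdivrMr //; lra.
apply: (@le_trans _ _ (expR (t * v + t ^+ 2 * (v * (C - v)) / 2 /
    (1 - t * (C - v) / 3)) ^+ n)).
  rewrite lerXn2r ?nnegrE ?expR_ge0 //; last exact: bernoulli_mgf_le.
  rewrite addr_ge0 // mulr_ge0 ?divr_ge0 //; first by lra.
  by rewrite subr_ge0 -[leLHS]expR0 ler_expR mulr_ge0 //; lra.
rewrite -expRM_natl ler_expR le_eqVlt; apply/orP; left; apply/eqP.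
have n0' : (n%:R : R) != 0 by rewrite pnatr_eq0 -lt0n.
have -> : 1 - t * (C - v) / 3 = n%:R * v / (n%:R * v + q / 3).
  by rewrite tL; field; rewrite lt0r_neq0 // ; lra.
rewrite /t; field; rewrite v_neq0 n0' !lt0r_neq0 //; lra.
Qed.

(** * Extrema of finite families; positivity of the least eigenvalue *)

Section FiniteRange.
Variables (R : realType) (n : nat) (f : 'I_n -> R).
Hypothesis n_gt0 : (0 < n)%N.

Lemma inf_range_attained :
  exists2 j, inf (range f) = f j & forall i, f j <= f i.
Proof.
have [j _ jmin] := @Order.TotalTheory.arg_minP _ _ _ (Ordinal n_gt0) xpredT f isT.
have jle i : f j <= f i by exact: jmin.
exists j => //; apply/eqP; rewrite eq_le; apply/andP; split.
  by apply: ge_inf; [exists (f j) => _ [i _ <-] | exists j].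
by apply: lb_le_inf => [|_ [i _ <-]//]; exists (f j), j.
Qed.

Lemma sup_range_ge i : f i <= sup (range f).
Proof.
have [j _ jmax] := @Order.TotalTheory.arg_maxP _ _ _ (Ordinal n_gt0) xpredT f isT.
apply: ub_le_sup; last by exists i.
by exists (f j) => _ [k _ <-]; exact: jmax.
Qed.

End FiniteRange.

(** Finitely many positive eigenvalues have a positive minimum, which bounds the form from below
    uniformly. *)
Lemma lambda_min_gt0 (R : realType) (m : nat) (A : 'M[R]_m) : (0 < m)%N ->
  sym_posdef A -> 0 < lambda_min A.
Proof.
move=> m0 [As Apos]; have [l [w [el w0 qE _]]] := spectral_expansion As.
have [j _ jmin] := inf_range_attained l m0.
have lj0 : 0 < l j.
  have [x [x0 qx]] := eigenvalue_qform (el j).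
  by rewrite -(pmulr_lgt0 _ x0) -qx; apply: Apos; rewrite -sqnorm2_gt0.
apply: lt_le_trans lj0 _; apply/(lambda_min_geP As m0) => x.
rewrite -qform1 -(expr0 A) -[A in leRHS]expr1 !qE mulr_sumr; apply: ler_sum => i _.
by rewrite expr0 mul1r expr1 ler_wpM2r.
Qed.

Lemma lambda_min_le_max (R : realType) (m : nat) (A : 'M[R]_m) : (0 < m)%N ->
  A^T = A -> lambda_min A <= lambda_max A.
Proof.
move=> m0 As; have [c ec] := eigenvalue_exists As m0.
have [x [x0 _]] := eigenvalue_qform ec.
have := (lambda_min_geP As m0 _).1 (lexx _) x.
move=> /le_trans/(_ ((lambda_max_leP As m0 _).1 (lexx _) x)).
by rewrite ler_pM2r.
Qed.

(** * Spectral bounds for inverses and the Sherman-Morrison formula *)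

Section InverseSandwich.
Variables (R : realType) (m : nat) (A : 'M[R]_m) (a b : R).
Hypotheses (Asym : A^T = A) (a_gt0 : 0 < a).
Hypothesis A_ge : forall x, a * sqnorm2 x <= qform A x.
Hypothesis A_le : forall x, qform A x <= b * sqnorm2 x.

Lemma sandwich_unitmx : A \in unitmx.
Proof.
rewrite unitmxE unitfE; apply/det0P => -[v v0 vA].
have := A_ge v^T; rewrite /qform trmxK vA mul0mx mxE leNgt mulr_gt0 //.
by rewrite sqnorm2_gt0 trmx_eq0.
Qed.

Lemma trmx_invmx : (invmx A)^T = invmx A.
Proof. by rewrite trmx_inv Asym. Qed.

Lemma invmx_eigenvalue_sandwich c : eigenvalue (invmx A) c -> b^-1 <= c <= a^-1.
Proof.
have Au := sandwich_unitmx.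
move=> /eigenvalueP[v vB v0].
have vE : v = c *: (v *m A) by rewrite scalemxAl -vB mulmxKV.
have c0 : c != 0 by apply: contraNneq v0 => c0; rewrite vE c0 scale0r.
have vA : v *m A = c^-1 *: v by rewrite {2}vE scalerA mulVf // scale1r.
have x0 : 0 < sqnorm2 v^T by rewrite sqnorm2_gt0 trmx_eq0.
have qx : qform A v^T = c^-1 * sqnorm2 v^T.
  by rewrite /qform trmxK vA sqnorm2E trmxK -scalemxAl mxE.
have ac : a <= c^-1 by rewrite -(ler_pM2r x0) -qx.
have cb : c^-1 <= b by rewrite -(ler_pM2r x0) -qx.
have ci0 : 0 < c^-1 := lt_le_trans a_gt0 ac.
have b0 : 0 < b := lt_le_trans ci0 cb.
by rewrite -[c]invrK !lef_pV2 ?posrE // ac cb.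
Qed.

(** Exponent 1 serves for h^T G h and exponent 2 for |G h|^2, where [G] is the inverse. *)
Lemma invmx_qform_exp_sandwich k x :
  b^-1 ^+ k * sqnorm2 x <= qform (invmx A ^+ k) x <= a^-1 ^+ k * sqnorm2 x.
Proof.
have [l [w [el w0 qE _]]] := spectral_expansion trmx_invmx.
have -> : sqnorm2 x = \sum_i w x i.
  rewrite -qform1 -(expr0 (invmx A)) qE.
  by apply: eq_bigr => i _; rewrite expr0 mul1r.
(* Nonnegativity of [b] needs a nonzero vector; an eigenvector attached to the current summand
   provides one. *)
rewrite qE !mulr_sumr; apply/andP; split; apply: ler_sum => i _;
  have /andP[bl la] := invmx_eigenvalue_sandwich (el i);
  have b0 : 0 <= b^-1.
- have [y [y0 _]] := eigenvalue_qform (el i).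
  rewrite invr_ge0 -(pmulr_lge0 _ y0) (le_trans _ (le_trans (A_ge y) (A_le y))) //.
  by rewrite mulr_ge0 ?ltW.
- by rewrite ler_wpM2r // lerXn2r // nnegrE (le_trans b0).
- have [y [y0 _]] := eigenvalue_qform (el i).
  rewrite invr_ge0 -(pmulr_lge0 _ y0) (le_trans _ (le_trans (A_ge y) (A_le y))) //.
  by rewrite mulr_ge0 ?ltW.
- have l0 := le_trans b0 bl.
  by rewrite ler_wpM2r // lerXn2r // nnegrE (le_trans l0).
Qed.

End InverseSandwich.

Lemma qform_sqr (R : realType) (m : nat) (A : 'M[R]_m) x :
  A^T = A -> qform (A ^+ 2) x = sqnorm2 (A *m x).
Proof.
by move=> As; rewrite sqnorm2E trmx_mul As /qform expr2 -mulmxE !mulmxA.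
Qed.

Lemma qform_rank_one (R : comNzRingType) (m : nat) (h x : 'cV[R]_m) :
  qform (h *m h^T) x = (h^T *m x) 0 0 ^+ 2.
Proof.
rewrite /qform mulmxA -mulmxA [LHS]mxE big_ord1 expr2; congr (_ * _).
by rewrite -[in LHS](trmxK h) -trmx_mul [LHS]mxE.
Qed.

Lemma sherman_morrison_trace (R : realType) (m : nat) (F : 'M[R]_m)
    (h : 'cV[R]_m) (s : R) :
  F^T = F -> F \in unitmx -> s != 0 -> s + qform (invmx F) h != 0 ->
  \tr (invmx F) - \tr (invmx (F + s^-1 *: (h *m h^T))) =
  sqnorm2 (invmx F *m h) / (s + qform (invmx F) h).
Proof.
move=> Fs Fu s0 sq0; set G := invmx F; set q := qform G h in sq0 *.
have Gs : G^T = G by rewrite /G trmx_inv Fs.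
pose K := h *m h^T *m G.
have qE : h *m h^T *m G *m h *m h^T *m G = q *: K.
  rewrite -[h *m h^T *m G]mulmxA -(mulmxA h).
  have -> : h^T *m G *m h = q%:M by rewrite [LHS]mx11_scalar.
  by rewrite mul_mx_scalar -!scalemxAl.
(* The candidate inverse is checked by multiplication: everything beyond the identity is a multiple
   of [K], with coefficient 1/s - 1/(s + q) - q / (s (s + q)) = 0. *)
have inv : (F + s^-1 *: (h *m h^T)) *m (G - (s + q)^-1 *: (G *m K)) = 1%:M.
  rewrite mulmxBr !mulmxDl mulmxV // -!scalemxAl -!scalemxAr -/K.
  rewrite mulmxA mulmxV // mul1mx /K !mulmxA qE -/K scalerA.
  rewrite opprD addrACA -[RHS]addr0 -addrA; congr (_ + _).
  rewrite scalerA -!(scaleNr _ K) -!scalerDl -[RHS](scale0r K); congr (_ *: _).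
  by field; rewrite s0 sq0.
have -> : invmx (F + s^-1 *: (h *m h^T)) = G - (s + q)^-1 *: (G *m K).
  have [Fu' _] := mulmx1_unit inv.
  by rewrite -[LHS]mulmx1 -inv mulKmx.
rewrite linearB linearZ /= opprB addrCA subrr addr0 mulrC; congr (_ * _).
rewrite /K -(mulmxA h) (mulmxA G h) mxtrace_mulC.
  rewrite sqnorm2E trmx_mul Gs.
by rewrite /mxtrace big_ord1 !mulmxA.
Qed.

(** * Part (i): bounds on marginal gains *)

Section SensorBounds.
Variables (R : realType) (n m : nat) (P : 'M[R]_m).
Variables (sigma2 : 'I_n -> R) (h : 'I_n -> 'cV[R]_m).
Hypotheses (n_gt0 : (0 < n)%N) (m_gt0 : (0 < m)%N).
Hypotheses (P_posdef : sym_posdef P) (sigma2_gt0 : forall j, 0 < sigma2 j).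

Let Psym : P^T = P. Proof. by case: P_posdef. Qed.
Implicit Types (S T U : {set 'I_n}).
Let F S := information_mx P sigma2 h S.

Let lmin_gt0 : 0 < lambda_min P. Proof. exact: lambda_min_gt0. Qed.
Let lmax_gt0 : 0 < lambda_max P.
Proof. exact: lt_le_trans lmin_gt0 (lambda_min_le_max _ _). Qed.

Let P_ge x : lambda_min P * sqnorm2 x <= qform P x.
Proof. exact: (lambda_min_geP Psym m_gt0 _).1. Qed.

Let P_le x : qform P x <= lambda_max P * sqnorm2 x.
Proof. exact: (lambda_max_leP Psym m_gt0 _).1. Qed.

Let Pinv_sandwich x :
  (lambda_max P)^-1 * sqnorm2 x <= qform (invmx P) x <= (lambda_min P)^-1 * sqnorm2 x.
Proof.
have := invmx_qform_exp_sandwich Psym lmin_gt0 P_ge P_le 1 x.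
by rewrite !expr1.
Qed.

Lemma information_mx_sym S : (F S)^T = F S.
Proof.
rewrite /F /information_mx linearD /= trmx_inv Psym; congr (_ + _).
rewrite linear_sum; apply: eq_bigr => i _ /=.
by rewrite linearZ /= trmx_mul trmxK.
Qed.

Lemma qform_information_mx S x : qform (F S) x =
  qform (invmx P) x + \sum_(i in S) (sigma2 i)^-1 * ((h i)^T *m x) 0 0 ^+ 2.
Proof.
rewrite /F /information_mx qformD qform_sum; congr (_ + _).
by apply: eq_bigr => i _; rewrite qformZ qform_rank_one.
Qed.

Lemma information_mx_ge S x : (lambda_max P)^-1 * sqnorm2 x <= qform (F S) x.
Proof.
rewrite qform_information_mx; case/andP: (Pinv_sandwich x) => lP _.
apply: le_trans lP _; rewrite lerDl sumr_ge0 // => i _.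
by rewrite mulr_ge0 ?sqr_ge0 // invr_ge0 ltW.
Qed.

Lemma information_mx_unit S : F S \in unitmx.
Proof.
by apply: (sandwich_unitmx _ (@information_mx_ge S)); rewrite invr_gt0.
Qed.

Lemma gram_measurement_mxE :
  (measurement_mx h)^T *m measurement_mx h = \sum_i h i *m (h i)^T.
Proof.
apply/matrixP => a b; rewrite mxE summxE; apply: eq_bigr => i _.
by rewrite !mxE big_ord1 !mxE.
Qed.

Lemma qform_gram x : qform ((measurement_mx h)^T *m measurement_mx h) x =
  \sum_i ((h i)^T *m x) 0 0 ^+ 2.
Proof.
rewrite gram_measurement_mxE qform_sum.
by apply: eq_bigr => i _; rewrite qform_rank_one.
Qed.

Lemma gram_sym :
  ((measurement_mx h)^T *m measurement_mx h)^T = (measurement_mx h)^T *m measurement_mx h.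
Proof. by rewrite trmx_mul trmxK. Qed.

Lemma marginal_trace_objective S i : i \notin S ->
  marginal (trace_objective P sigma2 h) i S =
  sqnorm2 (invmx (F S) *m h i) / (sigma2 i + qform (invmx (F S)) (h i)).
Proof.
move=> iS; rewrite -sherman_morrison_trace ?information_mx_sym //.
- have tE U : trace_objective P sigma2 h U = \tr P - \tr (invmx (F U)).
    by rewrite /trace_objective linearB.
  rewrite /marginal !tE opprB addrC addrA subrK; congr (_ - \tr (invmx _)).
  rewrite -/(F _) /F /information_mx big_setU1 //= -addrA; congr (_ + _).
  by rewrite addrC.
- exact: information_mx_unit.
- by rewrite gt_eqF.
- rewrite gt_eqF // ltr_pwDl //.
  (* With y = F^-1 h, h^T F^-1 h = y^T F y, so the lower bound on [F S] shows that it is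
     nonnegative. *)
  have -> : qform (invmx (F S)) (h i) = qform (F S) (invmx (F S) *m h i).
    rewrite /qform trmx_mul trmx_inv information_mx_sym !mulmxA.
    by rewrite mulmxKV ?information_mx_unit.
  apply: le_trans (information_mx_ge S _).
  by rewrite mulr_ge0 ?sqnorm2_ge0 // invr_ge0 ltW.
Qed.

Variables (C phi : R).
Hypotheses (hC : forall j, sqnorm2 (h j) <= C) (phi_gt0 : 0 < phi).
Hypothesis phi_lt : phi < lambda_min P.
Hypothesis spec : spectral_condition P sigma2 h phi.

(** Each weight is at most the inverse of the least variance, and the sum over [S] is at most the
    full Gram form; the spectral condition bounds that by exactly the gap between 1/phi and
    1/lambda_min(P). *)
Lemma information_mx_le S x : qform (F S) x <= phi^-1 * sqnorm2 x.
Proof.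
have [j sj smin] := inf_range_attained sigma2 n_gt0.
have gle := (lambda_max_leP gram_sym m_gt0 _).1 spec x.
rewrite qform_gram in gle.
rewrite qform_information_mx; case/andP: (Pinv_sandwich x) => _ lP.
have -> : phi^-1 = (lambda_min P)^-1 + (phi^-1 - (lambda_min P)^-1) by ring.
rewrite mulrDl lerD //.
apply: (@le_trans _ _ ((sigma2 j)^-1 * \sum_i ((h i)^T *m x) 0 0 ^+ 2)).
  rewrite mulr_sumr [leRHS](bigID (mem S)) /=; apply: ler_wpDr.
    by apply: sumr_ge0 => i _; rewrite mulr_ge0 ?sqr_ge0 // invr_ge0 ltW.
  by apply: ler_sum => i _; rewrite ler_wpM2r ?sqr_ge0 // lef_pV2 ?posrE.
rewrite ler_pdivrMl //; apply: le_trans gle _.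
by rewrite sj mulrCA mulrA.
Qed.

Let Finv_sandwich S k x : phi ^+ k * sqnorm2 x <= qform (invmx (F S) ^+ k) x <=
  lambda_max P ^+ k * sqnorm2 x.
Proof.
have lV : 0 < (lambda_max P)^-1 by rewrite invr_gt0.
have := invmx_qform_exp_sandwich (information_mx_sym S) lV
  (@information_mx_ge S) (@information_mx_le S) k x.
by rewrite !invrK.
Qed.

(** Bound the gain at [T] from above and the gain at [S] from below through the eigenvalue range
    [phi, L] of both inverses. One factor a = |h_i|^2 cancels, and what remains is nondecreasing in
    [a], so [a] may be replaced by [C]. *)
Lemma marginal_ratio_le S T i : i \notin S -> i \notin T ->
  marginal (trace_objective P sigma2 h) i T /
  marginal (trace_objective P sigma2 h) i S <=
  (lambda_max P ^+ 2 * (sigma2 i + lambda_max P * C)) /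
    (phi ^+ 2 * (sigma2 i + phi * C)).
Proof.
move=> iS iT; rewrite !marginal_trace_objective //.
have Gs U : (invmx (F U))^T = invmx (F U) by rewrite trmx_inv information_mx_sym.
have s0 := sigma2_gt0 i.
have Ca := hC i.
have a0 := sqnorm2_ge0 (h i).
have := Finv_sandwich S 1 (h i); have := Finv_sandwich T 1 (h i).
have := Finv_sandwich S 2 (h i); have := Finv_sandwich T 2 (h i).
rewrite !qform_sqr // !expr1.
set a := sqnorm2 (h i) in Ca a0 *; set L := lambda_max P.
set NT := sqnorm2 _; set NS := sqnorm2 (invmx (F S) *m h i).
set gT := qform _ _; set gS := qform (invmx (F S)) _.
move=> /andP[_ NTle] /andP[NSge _] /andP[gTge _] /andP[_ gSle].
have pL : phi <= L.
  by apply: ltW; apply: lt_le_trans phi_lt _; exact: lambda_min_le_max.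
have C0 : 0 <= C by exact: le_trans a0 Ca.
have L0 : 0 < L by exact: lmax_gt0.
have pC0 : 0 < sigma2 i + phi * C by rewrite ltr_pwDl // mulr_ge0 // ltW.
have LC0 : 0 < sigma2 i + L * C by rewrite ltr_pwDl // mulr_ge0 // ltW.
(* Here h_i = 0: the numerator vanishes and the quotient is 0 by convention. *)
have [az|an] := eqVneq a 0.
  have -> : NT = 0.
    by apply/eqP; rewrite eq_le sqnorm2_ge0 andbT (le_trans NTle) // az mulr0.
  rewrite !mul0r divr_ge0 // mulr_ge0 ?exprn_ge0 ?ltW //.
have ap : 0 < a by rewrite lt0r an.
have dT : 0 < sigma2 i + phi * a by rewrite ltr_pwDl // mulr_ge0 // ltW.
have dS : 0 < sigma2 i + L * a by rewrite ltr_pwDl // mulr_ge0 // ltW.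
have NS0 : 0 < phi ^+ 2 * a by rewrite mulr_gt0 // exprn_gt0.
have gS0 : 0 <= gS.
  have /andP[+ _] := Finv_sandwich S 1 (h i); rewrite !expr1.
  by apply: le_trans; rewrite mulr_ge0 // ltW.
have gT0 : 0 <= gT by apply: le_trans gTge; rewrite mulr_ge0 // ltW.
have dTg : 0 < sigma2 i + gT by rewrite ltr_pwDl.
have dSg : 0 < sigma2 i + gS by rewrite ltr_pwDl.
apply: (@le_trans _ _ ((L ^+ 2 * a / (sigma2 i + phi * a)) /
                       (phi ^+ 2 * a / (sigma2 i + L * a)))).
  apply: ler_pM.
  - by rewrite divr_ge0 ?sqnorm2_ge0 // ltW.
  - by rewrite invr_ge0 divr_ge0 ?sqnorm2_ge0 // ltW.
  - apply: ler_pM => //; first exact: sqnorm2_ge0.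
      by rewrite invr_ge0 ltW.
    by rewrite lef_pV2 ?posrE // lerD2l.
  - rewrite lef_pV2 ?posrE ?divr_gt0 //; last exact: lt_le_trans NS0 NSge.
    apply: ler_pM => //; first exact: ltW.
      by rewrite invr_ge0 ltW.
    by rewrite lef_pV2 ?posrE // lerD2l.
have -> : L ^+ 2 * a / (sigma2 i + phi * a) / (phi ^+ 2 * a / (sigma2 i + L * a)) =
    L ^+ 2 / phi ^+ 2 * ((sigma2 i + L * a) / (sigma2 i + phi * a)).
  by field; rewrite !gt_eqF.
have -> : L ^+ 2 * (sigma2 i + L * C) / (phi ^+ 2 * (sigma2 i + phi * C)) =
    L ^+ 2 / phi ^+ 2 * ((sigma2 i + L * C) / (sigma2 i + phi * C)).
  by field; rewrite !gt_eqF.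
(* After cross-multiplication, monotonicity in [a] amounts to sigma_i^2 (L - phi)(C - a) >= 0. *)
rewrite ler_wpM2l ?divr_ge0 ?sqr_ge0 // ler_pdivrMr // mulrAC ler_pdivlMr //.
rewrite -subr_ge0.
have -> : (sigma2 i + L * C) * (sigma2 i + phi * a) -
    (sigma2 i + L * a) * (sigma2 i + phi * C) = sigma2 i * ((L - phi) * (C - a)).
  by ring.
by rewrite mulr_ge0 ?(ltW s0) // mulr_ge0 // subr_ge0.
Qed.

End SensorBounds.

(** Unfolds both suprema into finitely many inequalities. This requires every set involved to be
    nonempty and bounded; proper inclusion expresses l >= 1, and l <= n - 1 holds because [T] misses
    [i]. *)
Lemma curvature_le_iff (R : realType) (n : nat) (f : {set 'I_n} -> R) (b : R) :
  (2 <= n)%N ->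
  curvature_max f <= b <->
  forall (S T : {set 'I_n}) i, S \proper T -> i \notin T ->
    marginal f i T / marginal f i S <= b.
Proof.
move=> n2.
pose g l := [set r : R | exists (S T : {set 'I_n}) (i : 'I_n),
  [/\ S \subset T, i \notin T, #|T :\: S| = l
    & r = marginal f i T / marginal f i S]].
(* A crude bound common to all levels: the sum of the absolute values of all ratios. *)
pose B := \sum_(p : {set 'I_n} * {set 'I_n} * 'I_n)
  `|marginal f p.2 p.1.2 / marginal f p.2 p.1.1|.
have gB l r : g l r -> r <= B.
  move=> [S [T [i [_ _ _ ->]]]]; rewrite /B (bigD1 (S, T, i)) //=.
  by rewrite ler_wpDr ?ler_norm // sumr_ge0.
have g0 l : (1 <= l <= n.-1)%N -> g l !=set0.
  move=> /andP[l1 ln].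
  have ln' : (l < n)%N by rewrite -ltnS prednK // in ln; exact: ltnW.
  (* Level [l] is inhabited: take [S] empty, [T] the first [l] indices and [i] the next one, which
     exists as l < n. *)
  pose T : {set 'I_n} := [set widen_ord (ltnW ln') j | j : 'I_l].
  exists (marginal f (Ordinal ln') T / marginal f (Ordinal ln') finset.set0).
  exists finset.set0, T, (Ordinal ln'); split => //; first exact: finset.sub0set.
    apply/imsetP => -[j _ /(congr1 (@nat_of_ord n)) /= lj].
    by have := ltn_ord j; rewrite -lj ltnn.
  rewrite finset.setD0 card_imset ?card_ord // => i j /(congr1 (@nat_of_ord n)) /= ij.
  exact: val_inj.
split=> [cb S T i ST iT|rb].
  have l1 : (1 <= #|T :\: S| <= n.-1)%N.
    move: ST; rewrite properE => /andP[_ TS]; apply/andP; split.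
      by rewrite card_gt0 finset.setD_eq0.
    apply: leq_trans (subset_leq_card (finset.subsetDl T S)) _.
    rewrite -[in leqRHS](card_ord n) -(cardsC1 i); apply: subset_leq_card.
    by apply/fintype.subsetP => j jT; rewrite !inE; apply: contraNneq iT => <-.
  apply: le_trans cb; apply: (@le_trans _ _ (curvature f #|T :\: S|)).
    apply: ub_le_sup; first by exists B => r /gB.
    by exists S, T, i; split => //; exact: proper_sub.
  apply: ub_le_sup; last by exists #|T :\: S|.
  exists B => _ [l /= l1' <-]; apply: ge_sup; first exact: g0.
  by move=> r /gB.
apply: ge_sup; first by exists (curvature f 1), 1%N => //=; rewrite -ltnS prednK // ltnW.
move=> _ [l /= l1 <-]; apply: ge_sup; first exact: g0.
move=> r [S [T [i [ST iT cl ->]]]]; apply: rb => //.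
by rewrite properE ST -finset.setD_eq0 -card_gt0 cl; case/andP: l1.
Qed.

Lemma curvature_bound_of_spectral (R : realType) (n m : nat) (P : 'M[R]_m)
    (sigma2 : 'I_n -> R) (h : 'I_n -> 'cV[R]_m) (C phi : R) :
  (2 <= n)%N -> (0 < m)%N -> sym_posdef P -> (forall j, 0 < sigma2 j) ->
  (forall j, sqnorm2 (h j) <= C) -> 0 < phi -> phi < lambda_min P ->
  spectral_condition P sigma2 h phi -> curvature_bound P sigma2 h C phi.
Proof.
move=> n2 m0 hP s0 hC p0 pl spec.
apply/(curvature_le_iff _ _ n2) => S T i /proper_sub/fintype.subsetP ST iT.
have n0 : (0 < n)%N by exact: ltnW.
have iS : i \notin S by apply: contra iT; exact: ST.
apply: le_trans (sup_range_ge _ n0 i).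
exact: (marginal_ratio_le n0 m0).
Qed.

(** * Independence from a generated sigma-algebra *)

Section Independence.
Context (R : realType) (d d' : measure_display).
Context (Omega : measurableType d) (T : measurableType d').
Context (Pr : probability Omega R) (G : set (set Omega)) (X : Omega -> T).
Hypothesis GI : setI_closed G.
Hypothesis Gm : G `<=` measurable.
Hypothesis mX : measurable_fun setT X.
Hypothesis XG : forall A B, measurable A -> G B ->
  Pr (X @^-1` A `&` B) = (Pr (X @^-1` A) * Pr B)%E.

Let sGm : <<s G >> `<=` (measurable : set (set Omega)).
Proof. by apply: smallest_sub => //; exact: sigma_algebra_measurable. Qed.

Let mXA A : measurable A -> measurable (X @^-1` A).
Proof. by move=> mA; rewrite -[X @^-1` A]setTI; exact: mX. Qed.

(** The pi-lambda argument: for fixed [A], the sets [B] obeying the product rule form a Dynkin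
    system containing the pi-system [G]. *)
Lemma indep_g_sigma_algebra A B : measurable A -> <<s G >> B ->
  Pr (X @^-1` A `&` B) = (Pr (X @^-1` A) * Pr B)%E.
Proof.
move=> mA; have mA' := mXA mA.
apply: (@dynkin_induction _ (g_sigma_algebraType G) G
  (fun B => Pr (X @^-1` A `&` B) = (Pr (X @^-1` A) * Pr B)%E)) => //.
- by rewrite setIT probability_setT mule1.
- by move=> S GS; exact: XG.
- move=> S /sGm mS PS; rewrite probability_setC // -setDE measureD //; last first.
    by rewrite ltey_eq fin_num_measure.
  have fS : Pr S \is a fin_num by exact: fin_num_measure.
  rewrite [RHS]muleBr ?fin_num_adde_defr ?fin_num_measure // mule1.
  by congr (_ - _)%E; exact: PS.
- move=> F mF tF PF.
  have mF' k : d.-measurable (F k : set Omega) by exact: sGm (mF k).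
  rewrite setI_bigcupr !measure_bigcup //.
  + rewrite -[in RHS](@fineK _ (Pr (X @^-1` A))) ?fin_num_measure //.
    rewrite -nneseriesZl //; apply: eq_eseriesr => k _.
    by rewrite fineK ?fin_num_measure //; exact: PF.
  + by move=> k _; exact: measurableI.
  + by apply: trivIset_setIl.
Qed.

Lemma indep_integral (f : T -> \bar R) (g : g_sigma_algebraType G -> \bar R) :
  measurable_fun setT f -> (forall x, 0 <= f x)%E ->
  measurable_fun setT g -> (forall w, 0 <= g w)%E ->
  (\int[Pr]_w (f (X w) * g w) = \int[Pr]_w f (X w) * \int[Pr]_w g w)%E.
Proof.
move=> mf f0 mg g0.
(* The identity, with the sub-sigma-algebra on its target, plays the second random variable. The
   joint law of [X] and [id] is then a product measure, and Tonelli's theorem factors the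
   integral. *)
have mid : measurable_fun setT (id : Omega -> g_sigma_algebraType G).
  by move=> _ B mB; rewrite setTI; exact: sGm.
pose Xf : {mfun Omega >-> T} := HB.pack X (isMeasurableFun.Build _ _ _ _ X mX).
pose idf : {mfun Omega >-> g_sigma_algebraType G} :=
  HB.pack (id : Omega -> g_sigma_algebraType G)
    (isMeasurableFun.Build _ _ _ _ (id : Omega -> g_sigma_algebraType G) mid).
pose Z := (fun w => (X w, w)) : Omega -> T * g_sigma_algebraType G.
have mZ : measurable_fun setT Z by exact: measurable_fun_pair.
pose Zf : {mfun Omega >-> (T * g_sigma_algebraType G)%type} :=
  HB.pack Z (isMeasurableFun.Build _ _ _ _ Z mZ).
pose F (z : T * g_sigma_algebraType G) := (f z.1 * g z.2)%E.
have mF : measurable_fun setT F.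
  by apply: emeasurable_funM; apply: measurableT_comp.
have F0 z : (0 <= F z)%E by exact: mule_ge0.
pose m1 := distribution Pr Xf; pose m2 := distribution Pr idf.
have mE A : measurable A -> (m1 \x m2)%E A = distribution Pr Zf A.
  apply: product_measure_unique => B D mB mD.
  exact: indep_g_sigma_algebra.
transitivity (\int[distribution Pr Zf]_z F z)%E.
  by rewrite ge0_integral_distribution.
rewrite (eq_measure_integral (m1 \x m2)%E); last by move=> A mA _; exact/esym/mE.
rewrite fubini_tonelli1 //.
transitivity (\int[m1]_x (f x * \int[m2]_y g y))%E.
  by apply: eq_integral => x _; rewrite /fubini_F /F /= ge0_integralZl.
rewrite ge0_integralZr //; last exact: integral_ge0.
by rewrite !ge0_integral_distribution.
Qed.

End Independence.

(** * Expectations of bounded measurable functions and matrices *)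

Definition bounded_measurable (R : realType) (d : measure_display)
    (T : measurableType d) (f : T -> R) : Prop :=
  measurable_fun [set: T] f /\ exists K, forall w, `|f w| <= K.

Section BoundedMeasurable.
Context (R : realType) (d : measure_display) (T : measurableType d).
Implicit Types f g : T -> R.

Lemma bounded_measurable_cst (c : R) : bounded_measurable (fun _ : T => c).
Proof. by split; [exact: measurable_cst | exists `|c|]. Qed.

Lemma bounded_measurableD f g : bounded_measurable f -> bounded_measurable g ->
  bounded_measurable (fun w => f w + g w).
Proof.
move=> [mf [K fK]] [mg [L gL]]; split; first exact: measurable_funD.
by exists (K + L) => w; apply: le_trans (ler_normD _ _) _; exact: lerD.
Qed.

Lemma bounded_measurableM f g : bounded_measurable f -> bounded_measurable g ->
  bounded_measurable (fun w => f w * g w).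
Proof.
move=> [mf [K fK]] [mg [L gL]]; split; first exact: measurable_funM.
by exists (K * L) => w; rewrite normrM ler_pM.
Qed.

Lemma bounded_measurable_sum (I : Type) (r : seq I) (F : I -> T -> R) :
  (forall i, bounded_measurable (F i)) ->
  bounded_measurable (fun w => \sum_(i <- r) F i w).
Proof.
move=> bF; elim: r => [|i r IH].
  by under eq_fun do rewrite big_nil; exact: bounded_measurable_cst.
by under eq_fun do rewrite big_cons; exact: bounded_measurableD.
Qed.

Variable Pr : probability T R.

Lemma bounded_measurable_integrable f : bounded_measurable f ->
  Pr.-integrable setT (EFin \o f).
Proof.
move=> [mf [K fK]]; apply: measurable_bounded_integrable => //.
  by apply: le_lt_trans (probability_le1 Pr measurableT) _; exact: ltry.
exists K; split; first exact: num_real.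
by move=> x Kx w _; apply: le_trans (fK w) (ltW Kx).
Qed.

Lemma Rexpectation_cst (c : R) : \int[Pr]_w c = c.
Proof.
rewrite Rintegral_cst // -[RHS]mulr1; congr (_ * _).
by rewrite -[RHS]/(fine 1%E) -(probability_setT Pr).
Qed.

Lemma RexpectationD f g : bounded_measurable f -> bounded_measurable g ->
  \int[Pr]_w (f w + g w) = \int[Pr]_w f w + \int[Pr]_w g w.
Proof.
by move=> bf bg; apply: RintegralD => //; exact: bounded_measurable_integrable.
Qed.

Lemma RexpectationZ f c : bounded_measurable f ->
  \int[Pr]_w (c * f w) = c * \int[Pr]_w f w.
Proof.
by move=> bf; apply: RintegralZl => //; exact: bounded_measurable_integrable.
Qed.

Lemma Rexpectation_sum (I : Type) (r : seq I) (F : I -> T -> R) :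
  (forall i, bounded_measurable (F i)) ->
  \int[Pr]_w (\sum_(i <- r) F i w) = \sum_(i <- r) \int[Pr]_w F i w.
Proof.
move=> bF; elim: r => [|i r IH].
  by rewrite big_nil; under eq_Rintegral do rewrite big_nil; exact: Rexpectation_cst.
rewrite big_cons -IH -RexpectationD //; last exact: bounded_measurable_sum.
by apply: eq_Rintegral => w _; rewrite big_cons.
Qed.

Lemma Rexpectation_le f g : bounded_measurable f -> bounded_measurable g ->
  (forall w, f w <= g w) -> \int[Pr]_w f w <= \int[Pr]_w g w.
Proof.
move=> bf bg fg.
by apply: le_Rintegral => //; exact: bounded_measurable_integrable.
Qed.

End BoundedMeasurable.

Section BoundedMeasurableMatrix.
Context (R : realType) (d : measure_display) (T : measurableType d).

Definition bounded_measurable_mx (p q : nat) (M : T -> 'M[R]_(p, q)) : Prop :=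
  forall i j, bounded_measurable (fun w => M w i j).

Lemma bounded_measurable_mx_cst p q (A : 'M[R]_(p, q)) :
  bounded_measurable_mx (fun=> A).
Proof. by move=> i j; exact: bounded_measurable_cst. Qed.

Lemma bounded_measurable_mxD p q (M N : T -> 'M[R]_(p, q)) :
  bounded_measurable_mx M -> bounded_measurable_mx N ->
  bounded_measurable_mx (fun w => M w + N w).
Proof.
move=> bM bN i j; under eq_fun do rewrite mxE.
exact: bounded_measurableD.
Qed.

Lemma bounded_measurable_mxZ p q c (M : T -> 'M[R]_(p, q)) :
  bounded_measurable_mx M -> bounded_measurable_mx (fun w => c *: M w).
Proof.
move=> bM i j; under eq_fun do rewrite mxE.
by apply: bounded_measurableM => //; exact: bounded_measurable_cst.
Qed.

Lemma bounded_measurable_mxM p q r (M : T -> 'M[R]_(p, q)) (N : T -> 'M[R]_(q, r)) :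
  bounded_measurable_mx M -> bounded_measurable_mx N ->
  bounded_measurable_mx (fun w => M w *m N w).
Proof.
move=> bM bN i j; under eq_fun do rewrite mxE.
by apply: bounded_measurable_sum => k; exact: bounded_measurableM.
Qed.

Lemma bounded_measurable_mx_sum p q (I : Type) (r : seq I) (M : I -> T -> 'M[R]_(p, q)) :
  (forall i, bounded_measurable_mx (M i)) ->
  bounded_measurable_mx (fun w => \sum_(i <- r) M i w).
Proof.
move=> bM i j; under eq_fun do rewrite summxE.
by apply: bounded_measurable_sum => k; exact: bM.
Qed.

Lemma bounded_measurable_mx_exp p (M : T -> 'M[R]_p) k :
  bounded_measurable_mx M -> bounded_measurable_mx (fun w => M w ^+ k).
Proof.
move=> bM; elim: k => [|k IH]; first exact: bounded_measurable_mx_cst.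
have -> : (fun w => M w ^+ k.+1) = (fun w => M w *m M w ^+ k).
  by apply/funext => w; rewrite exprS.
exact: bounded_measurable_mxM.
Qed.

Lemma bounded_measurable_expmx_trunc p t N (M : T -> 'M[R]_p) :
  bounded_measurable_mx M ->
  bounded_measurable_mx (fun w => expmx_trunc t N (M w)).
Proof.
move=> bM; rewrite /expmx_trunc.
apply: (bounded_measurable_mx_sum _
  (M := fun (k : 'I_N) w => (t ^+ k / k`!%:R) *: M w ^+ k)) => k.
by apply: bounded_measurable_mxZ; exact: bounded_measurable_mx_exp.
Qed.

Lemma bounded_measurable_trace p (M : T -> 'M[R]_p) :
  bounded_measurable_mx M -> bounded_measurable (fun w => \tr (M w)).
Proof.
move=> bM; apply: (bounded_measurable_sum _ (F := fun i w => M w i i)) => i.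
exact: bM.
Qed.

End BoundedMeasurableMatrix.

Section IndependentExpectation.
Context (R : realType) (d d' : measure_display).
Context (Omega : measurableType d) (T : measurableType d').
Context (Pr : probability Omega R) (G : set (set Omega)) (X : Omega -> T).
Hypothesis GI : setI_closed G.
Hypothesis Gm : G `<=` measurable.
Hypothesis mX : measurable_fun setT X.
Hypothesis XG : forall A B, measurable A -> G B ->
  Pr (X @^-1` A `&` B) = (Pr (X @^-1` A) * Pr B)%E.

Lemma bounded_measurable_sub (g : g_sigma_algebraType G -> R) :
  bounded_measurable g -> bounded_measurable (g : Omega -> R).
Proof.
move=> [mg bg]; split => // mT B mB; have := mg measurableT B mB.
rewrite !setTI; apply: smallest_sub => //.
exact: sigma_algebra_measurable.
Qed.

Lemma bounded_measurable_comp (f : T -> R) :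
  bounded_measurable f -> bounded_measurable (fun w => f (X w)).
Proof.
move=> [mf [K fK]]; split; last by exists K => w; exact: fK.
exact: (measurableT_comp mf mX).
Qed.

Let indep_ge0 (f : T -> R) (g : g_sigma_algebraType G -> R) :
  bounded_measurable f -> bounded_measurable g ->
  (forall x, 0 <= f x) -> (forall w, 0 <= g w) ->
  \int[Pr]_w (f (X w) * g w) = (\int[Pr]_w f (X w)) * \int[Pr]_w g w.
Proof.
move=> bf bg f0 g0.
have fX := bounded_measurable_integrable Pr (bounded_measurable_comp bf).
have gO := bounded_measurable_integrable Pr (bounded_measurable_sub bg).
rewrite /Rintegral -fineM; try exact: integrable_fin_num.
congr fine; rewrite -(indep_integral GI Gm mX XG
  (f := EFin \o f) (g := EFin \o (g : g_sigma_algebraType G -> R))) //.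
- by apply/measurable_EFinP; case: bf.
- by apply/measurable_EFinP; case: bg.
Qed.

(** Adding their bounds makes [f] and [g] nonnegative; after expansion the additional terms agree on
    both sides. *)
Lemma indep_Rexpectation (f : T -> R) (g : g_sigma_algebraType G -> R) :
  bounded_measurable f -> bounded_measurable g ->
  \int[Pr]_w (f (X w) * g w) = (\int[Pr]_w f (X w)) * \int[Pr]_w g w.
Proof.
move=> bf bg; have [_ [K fK]] := bf; have [_ [L gL]] := bg.
have bfX := bounded_measurable_comp bf; have bgO := bounded_measurable_sub bg.
have bfK : bounded_measurable (fun x => f x + K).
  by apply: bounded_measurableD => //; exact: bounded_measurable_cst.
have bgL : bounded_measurable (fun w => g w + L).
  by apply: bounded_measurableD => //; exact: bounded_measurable_cst.
have f0 x : 0 <= f x + K by have := fK x; rewrite ler_norml => /andP[]; lra.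
have g0 x : 0 <= g x + L by have := gL x; rewrite ler_norml => /andP[]; lra.
have := indep_ge0 bfK bgL f0 g0.
rewrite !RexpectationD //; try exact: bounded_measurable_cst.
rewrite !Rexpectation_cst.
have -> : \int[Pr]_w ((f (X w) + K) * (g w + L)) =
   \int[Pr]_w (f (X w) * g w) + L * \int[Pr]_w f (X w) + K * \int[Pr]_w g w + K * L.
  have -> : (fun w => (f (X w) + K) * (g w + L)) =
      (fun w => f (X w) * g w + L * f (X w) + K * g w + K * L).
    by apply/funext => w; ring.
  have bc (c : R) := bounded_measurable_cst Omega c.
  have b1 := bounded_measurableM bfX bgO.
  have b2 := bounded_measurableM (bc L) bfX.
  have b3 := bounded_measurableM (bc K) bgO.
  rewrite (RexpectationD _ (bounded_measurableD (bounded_measurableD b1 b2) b3) (bc _)).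
  rewrite (RexpectationD _ (bounded_measurableD b1 b2) b3) (RexpectationD _ b1 b2).
  by rewrite Rexpectation_cst !RexpectationZ.
move=> H; apply: (addIr (L * \int[Pr]_w f (X w) + K * \int[Pr]_w g w + K * L)).
by rewrite !addrA H; ring.
Qed.

End IndependentExpectation.

Lemma qform_sumE (R : comNzRingType) (m : nat) (A : 'M[R]_m) (x : 'cV[R]_m) :
  qform A x = \sum_a \sum_b x a 0 * x b 0 * A a b.
Proof.
rewrite /qform -mulmxA mxE; apply: eq_bigr => a _; rewrite !mxE mulr_sumr.
by apply: eq_bigr => b _; rewrite mulrA mulrAC.
Qed.

Lemma trace_expmx_trunc0_le (R : realType) (m : nat) (t : R) N :
  \tr (expmx_trunc t N (0 : 'M[R]_m)) <= m%:R.
Proof.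
rewrite linear_sum /=; case: N => [|N]; first by rewrite big_ord0.
rewrite big_ord_recl big1 => [|k _]; last by rewrite expr0n /= scaler0 linear0.
by rewrite /= addr0 expr0 expr0 divr1 scale1r mxtrace1.
Qed.

(** * Borel vectors and truncation *)

Section BorelVector.
Context (R : realType) (m : nat).

Lemma measurable_entry (a : 'I_m) :
  measurable_fun [set: borel_cV R m] (fun x => (x : 'cV[R]_m) a 0).
Proof.
apply: (measurability (@RGenOInfty.G R)); first exact: RGenOInfty.measurableE.
move=> _ [_ [y ->] <-]; rewrite setTI; apply: sub_sigma_algebra.
by apply: (continuousP _).1; [exact: coord_continuous | exact: interval_open].
Qed.

Lemma measurable_sqnorm2 :
  measurable_fun [set: borel_cV R m] (fun x => sqnorm2 (x : 'cV[R]_m)).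
Proof.
apply: (measurable_sum _ (h := fun a (x : borel_cV R m) => (x : 'cV[R]_m) a 0 ^+ 2)) => a.
by apply: measurable_funX; exact: measurable_entry.
Qed.

Variable C : R.

(** Turns the almost sure bound on |h|^2 into one valid everywhere, changing a vector only on a null
    event. *)
Definition truncate (x : 'cV[R]_m) : 'cV[R]_m := if sqnorm2 x <= C then x else 0.

Lemma truncate_id x : sqnorm2 x <= C -> truncate x = x.
Proof. by rewrite /truncate => ->. Qed.

Lemma sqnorm2_truncate_le x : 0 <= C -> sqnorm2 (truncate x) <= C.
Proof.
rewrite /truncate; case: ifP => // _ C0; rewrite /sqnorm2 big1 // => i _.
by rewrite mxE expr0n.
Qed.

Lemma bounded_measurable_truncate (a : 'I_m) : 0 <= C ->
  bounded_measurable (fun x : borel_cV R m => truncate x a 0).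
Proof.
move=> C0; split.
  have -> : (fun x : borel_cV R m => truncate x a 0) =
      (fun x : borel_cV R m => if sqnorm2 (x : 'cV[R]_m) <= C
         then (x : 'cV[R]_m) a 0 else 0).
    by apply/funext => x; rewrite /truncate; case: ifP => // _; rewrite mxE.
  apply: measurable_fun_ifT => //; last exact: measurable_entry.
  by apply: measurable_fun_ler => //; exact: measurable_sqnorm2.
(* From y^2 <= C and 2|y| <= 1 + y^2, without square roots. *)
exists (1 + C) => x; set y := truncate x a 0.
have : `|y| ^+ 2 <= C.
  apply: le_trans (sqnorm2_truncate_le x C0); rewrite real_normK ?num_real //.
  by rewrite /sqnorm2 (bigD1 a) //= lerDl sumr_ge0 // => i _; exact: sqr_ge0.
by have := sqr_ge0 (`|y| - 1); nra.
Qed.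

End BorelVector.

(** * The matrix Chernoff bound for sums of rank-one terms *)

Section MatrixChernoff.
Context (R : realType) (n m : nat) (d : measure_display).
Context (Omega : measurableType d) (Pr : probability Omega R).
Variables (h : 'I_n -> {RV Pr >-> borel_cV R m}) (v C : R).
Hypothesis h_indep : independent_vectors h.
Hypothesis h_mean : forall j, zero_mean Pr (h j).
Hypothesis h_cov : forall j, has_covariance_mx Pr (h j) (v%:M).
Hypothesis h_bound : forall j, {ae Pr, forall w, sqnorm2 (h j w) <= C}.
Hypothesis C_gt0 : 0 < C.

Implicit Types s r : seq 'I_n.

Let g j w : 'cV[R]_m := truncate C (h j w).
Let S (s : seq 'I_n) w : 'M[R]_m := \sum_(j <- s) g j w *m (g j w)^T.

Let g_le j w : sqnorm2 (g j w) <= C.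
Proof. by apply: sqnorm2_truncate_le; exact: ltW. Qed.

(** Truncation changes nothing almost everywhere, and with zero mean the covariance is the plain
    second moment. *)
Let truncated_second_moment k a b :
  \int[Pr]_w (g k w a 0 * g k w b 0) = v *+ (a == b).
Proof.
have mh c : measurable_fun setT (fun w => (h k w : 'cV[R]_m) c 0).
  by apply: (measurableT_comp (measurable_entry c)).
have mg c : measurable_fun setT (fun w => g k w c 0).
  apply: (measurableT_comp (f := fun x : borel_cV R m => truncate C x c 0)) => //.
  by case: (bounded_measurable_truncate c (ltW C_gt0)).
have := h_cov k a b; rewrite unlock /=.
have := h_mean k a; have := h_mean k b; rewrite /zero_mean => -> -> /=.
rewrite unlock mxE => covE; rewrite /Rintegral -[RHS]/(fine _%:E) -covE; congr fine.
apply: ae_eq_integral => //.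
- by apply/measurable_EFinP; exact: measurable_funM.
- apply/measurable_EFinP; apply: measurable_funM;
    by apply: measurable_funB => //; exact: mh.
- have := h_bound k; apply: filterS => w hw _ /=.
  rewrite /g truncate_id //; congr (_%:E).
  by rewrite -[RHS]/((Defs.coord (h k) a w - 0) * (Defs.coord (h k) b w - 0)) !subr0.
Qed.

(** The pi-system of rectangles, generating the sigma-algebra of the vectors [h j] with [j] in
    [s]. *)
Let G (s : seq 'I_n) : set (set Omega) :=
  [set F | exists B : 'I_n -> set (borel_cV R m), (forall j, measurable (B j)) /\
    F = \bigcap_(j in [set j | j \in s]) (h j @^-1` B j)].

Let mh_preimage j (B : set (borel_cV R m)) : measurable B -> measurable (h j @^-1` B).
Proof. by move=> mB; rewrite -[_ @^-1` _]setTI; exact: measurable_funPT. Qed.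

Let GI s : setI_closed (G s).
Proof.
move=> _ _ [A [mA ->]] [B [mB ->]]; exists (fun j => A j `&` B j); split.
  by move=> j; exact: measurableI.
by rewrite -bigcapI; apply: eq_bigcapr => j _; rewrite preimage_setI.
Qed.

Let Gm s : G s `<=` measurable.
Proof.
move=> _ [B [mB ->]]; apply: fin_bigcap_measurable => // j _.
exact: mh_preimage.
Qed.

Let Gprob s (B : 'I_n -> set (borel_cV R m)) : (forall j, measurable (B j)) ->
  Pr (\bigcap_(j in [set j | j \in s]) (h j @^-1` B j)) =
  (\prod_(j < n) Pr (h j @^-1` (if j \in s then B j else setT)))%E.
Proof.
move=> mB; rewrite -h_indep; last by move=> j; case: ifP.
congr (Pr _); apply/seteqP; split => w /= H j.
  by move=> _; case: ifPn => // js; exact: H.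
by move=> js; have := H j I; rewrite /= js.
Qed.

Let Gindep s k A F : k \notin s -> measurable A -> G s F ->
  Pr (h k @^-1` A `&` F) = (Pr (h k @^-1` A) * Pr F)%E.
Proof.
move=> ks mA [B [mB ->]].
(* The intersection is a rectangle over [k :: s], to which the product rule applies. *)
pose B' j := if j == k then A else B j.
have -> : h k @^-1` A `&` \bigcap_(j in [set j | j \in s]) (h j @^-1` B j) =
    \bigcap_(j in [set j | j \in k :: s]) (h j @^-1` B' j).
  apply/seteqP; split => [w [/= Aw Bw] j|w H].
    rewrite /= in_cons /B' => /orP[/eqP ->|js]; first by rewrite eqxx.
    by case: eqP => [jk|_]; [move: ks; rewrite -jk js | exact: Bw].
  split; first by have := H k; rewrite /B' /= eqxx in_cons eqxx; apply.
  move=> j js; have := H j; rewrite /= in_cons /B' (_ : j == k = false).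
    by rewrite orFb; apply.
  by apply: contraNF ks => /eqP <-.
rewrite !Gprob //; last by move=> j; rewrite /B'; case: ifP.
rewrite (bigD1 k) //= [in RHS](bigD1 k) //= in_cons eqxx /= /B' eqxx (negbTE ks).
rewrite preimage_setT probability_setT mul1e; congr (_ * _)%E.
by apply: eq_bigr => j jk; rewrite in_cons (negbTE jk).
Qed.

Let g_meas s j a : j \in s ->
  bounded_measurable (fun w : g_sigma_algebraType (G s) => g j w a 0).
Proof.
move=> js; have [mt [K tK]] := bounded_measurable_truncate a (ltW C_gt0).
split; last by exists K => w; exact: tK.
apply: (measurableT_comp (f := fun x : borel_cV R m => truncate C x a 0)) => //.
move=> _ B mB; rewrite setTI; apply: sub_sigma_algebra.
exists (fun i => if i == j then B else setT); split.
  by move=> i; case: ifP.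
apply/seteqP; split => [w /= Bw i _|w /(_ j js)]; last by rewrite eqxx.
by case: eqP => [->|].
Qed.

Let S_meas s r : {subset r <= s} ->
  bounded_measurable_mx (fun w : g_sigma_algebraType (G s) => S r w).
Proof.
elim: r => [|j r IH] rs a b.
  by rewrite /S; under eq_fun do rewrite big_nil; exact: bounded_measurable_mx_cst.
rewrite /S; under eq_fun do rewrite big_cons.
apply: bounded_measurable_mxD; last first.
  by apply: IH => i ir; apply: rs; rewrite in_cons ir orbT.
have js : j \in s by apply: rs; rewrite mem_head.
apply: bounded_measurable_mxM => a' b'; last under eq_fun do rewrite mxE.
  by rewrite ord1; exact: g_meas.
by rewrite ord1; exact: g_meas.
Qed.

Let S_sym s w : (S s w)^T = S s w.
Proof.
rewrite /S linear_sum; apply: eq_bigr => j _ /=.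
by rewrite trmx_mul trmxK.
Qed.

Let S_psd s w : psd (S s w).
Proof.
move=> x; rewrite /S qform_sum; apply: sumr_ge0 => j _.
by rewrite qform_rank_one sqr_ge0.
Qed.

Let u t N s := \int[Pr]_w \tr (expmx_trunc t N (S s w)).

Let S_bounded s : bounded_measurable_mx (S s).
Proof.
by move=> a b; apply: (bounded_measurable_sub (@Gm s)); exact: S_meas.
Qed.

(** Integrate the pointwise bound [trace_expmx_trunc_update] at [A = S s w]; the new vector [h k] is
    independent of that matrix. *)
Let expected_trace_step t N k s : k \notin s -> 0 <= t ->
  u t N (k :: s) <= (1 + v / C * (expR (t * C) - 1)) * u t N s.
Proof.
move=> ks t0.
pose M (w : Omega) := expmx_trunc t N (S s w).
pose phi a b (x : borel_cV R m) := truncate C x a 0 * truncate C x b 0.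
have bphi a b : bounded_measurable (phi a b).
  by apply: bounded_measurableM; apply: bounded_measurable_truncate; exact: ltW.
have bM : bounded_measurable_mx (fun w : g_sigma_algebraType (G s) => M w).
  by apply: bounded_measurable_expmx_trunc; exact: S_meas.
have bMO : bounded_measurable_mx M by exact: bounded_measurable_expmx_trunc.
have mhk : measurable_fun setT (h k) by [].
have bphik a b : bounded_measurable (fun w => phi a b (h k w)).
  exact: bounded_measurable_comp.
have bterm a b : bounded_measurable (fun w => phi a b (h k w) * M w a b).
  by apply: bounded_measurableM => //; exact: bMO.
(* Entry by entry, independence replaces g_a g_b by its mean, [v] on the diagonal and 0 off it, so
   only the trace of [M] survives. *)
have Eq : \int[Pr]_w qform (M w) (g k w) = v * u t N s.
  have -> : (fun w => qform (M w) (g k w)) =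
      (fun w => \sum_a \sum_b phi a b (h k w) * M w a b).
    by apply/funext => w; rewrite qform_sumE.
  rewrite Rexpectation_sum; last by move=> a; exact: bounded_measurable_sum.
  rewrite /u /mxtrace Rexpectation_sum; last by move=> a; exact: bMO.
  rewrite mulr_sumr; apply: eq_bigr => a _; rewrite Rexpectation_sum //.
  rewrite (bigD1 a) //= big1 ?addr0 => [|b ba].
    rewrite (indep_Rexpectation (@GI s) (@Gm s) mhk _ (bphi a a) (bM a a)); last first.
      by move=> A B; exact: Gindep.
    by rewrite truncated_second_moment eqxx.
  rewrite (indep_Rexpectation (@GI s) (@Gm s) mhk _ (bphi a b) (bM a b)); last first.
    by move=> A B; exact: Gindep.
  by rewrite truncated_second_moment eq_sym (negbTE ba) mul0r.
have bq : bounded_measurable (fun w => qform (M w) (g k w)).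
  have -> : (fun w => qform (M w) (g k w)) =
      (fun w => \sum_a \sum_b phi a b (h k w) * M w a b).
    by apply/funext => w; rewrite qform_sumE.
  by apply: bounded_measurable_sum => a; exact: bounded_measurable_sum.
pose e := expR (t * C) - 1.
have bT r : bounded_measurable (fun w => \tr (expmx_trunc t N (S r w))).
  by apply: bounded_measurable_trace; exact: bounded_measurable_expmx_trunc.
have bcq : bounded_measurable (fun w => e / C * qform (M w) (g k w)).
  by apply: bounded_measurableM => //; exact: bounded_measurable_cst.
have -> : (1 + v / C * (expR (t * C) - 1)) * u t N s =
    u t N s + e / C * (v * u t N s) by rewrite /e; ring.
rewrite -Eq -RexpectationZ // -RexpectationD //.
apply: Rexpectation_le => //; first exact: bounded_measurableD.
move=> w; rewrite -lerBlDl mulrAC ler_pdivlMr // mulrC.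
have -> : S (k :: s) w = S s w + g k w *m (g k w)^T.
  by rewrite /S big_cons addrC.
exact: trace_expmx_trunc_update.
Qed.

Let expected_trace_le t N s : uniq s -> 0 <= t -> 0 <= v ->
  u t N s <= m%:R * (1 + v / C * (expR (t * C) - 1)) ^+ size s.
Proof.
move=> + t0 v0; elim: s => [_|k s IH /= /andP[ks us]].
  rewrite mulr1 /u; have -> : (fun w => \tr (expmx_trunc t N (S [::] w))) =
      fun=> \tr (expmx_trunc t N (0 : 'M[R]_m)).
    by apply/funext => w; rewrite /S big_nil.
  by rewrite Rexpectation_cst trace_expmx_trunc0_le.
apply: le_trans (expected_trace_step N ks t0) _.
rewrite exprS mulrCA ler_wpM2l ?IH // addr_ge0 // mulr_ge0 ?divr_ge0 // ?(ltW C_gt0) //.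
by rewrite subr_ge0 -[leLHS]expR0 ler_expR mulr_ge0 // ltW.
Qed.

(** Markov's inequality for the truncated series: on [B] the trace dominates the partial sum of
    exp(ts), whereas its expectation grows by a fixed factor with each of the [n] vectors. *)
Lemma matrix_chernoff (B : set Omega) (t s : R) : measurable B -> 0 <= t -> 0 <= v ->
  0 <= s ->
  (forall w, B w -> forall k, s ^+ k <=
     \tr ((\sum_j truncate C (h j w) *m (truncate C (h j w))^T) ^+ k)) ->
  fine (Pr B) * expR (t * s) <= m%:R * (1 + v / C * (expR (t * C) - 1)) ^+ n.
Proof.
move=> mB t0 v0 s0 Bs; set K := m%:R * _.
have K0 : 0 <= K.
  rewrite mulr_ge0 // exprn_ge0 // addr_ge0 // mulr_ge0 ?divr_ge0 // ?(ltW C_gt0) //.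
  by rewrite subr_ge0 -[leLHS]expR0 ler_expR mulr_ge0 // ltW.
have P0 : 0 <= fine (Pr B) by rewrite fine_ge0.
have [->|Pn] := eqVneq (fine (Pr B)) 0; first by rewrite mul0r.
have Pp : 0 < fine (Pr B) by rewrite lt0r Pn.
(* Isolating exp(ts) lets it be bounded through its partial sums; the bound on the expectation is
   uniform in [N]. *)
rewrite mulrC -ler_pdivlMr //; apply: expR_le_of_partial_sums => N.
rewrite ler_pdivlMr //; set c := \sum_(k < N) _.
have := @expected_trace_le t N (enum 'I_n) (enum_uniq _) t0 v0.
rewrite size_enum_ord; apply: le_trans.
have bB : bounded_measurable (\1_B : Omega -> R).
  split; first exact: measurable_indic.
  by exists 1 => w; rewrite indicE; case: (w \in B); rewrite ?normr1 ?normr0.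
have -> : fine (Pr B) = \int[Pr]_w (\1_B w).
  by rewrite /Rintegral integral_indic // setIT.
rewrite -RexpectationZ //; apply: Rexpectation_le.
- by apply: bounded_measurableM => //; exact: bounded_measurable_cst.
- by apply: bounded_measurable_trace; exact: bounded_measurable_expmx_trunc.
move=> w.
have trE : \tr (expmx_trunc t N (S (enum 'I_n) w)) =
    \sum_(k < N) t ^+ k / k`!%:R * \tr (S (enum 'I_n) w ^+ k).
  by rewrite linear_sum; apply: eq_bigr => k _; rewrite linearZ.
have w0 k : 0 <= t ^+ k / k`!%:R by rewrite divr_ge0 ?exprn_ge0.
rewrite trE indicE; have [wB|wB] := boolP (w \in B); last first.
  rewrite mulr0; apply: sumr_ge0 => k _; rewrite mulr_ge0 //.
  by apply: trace_exp_ge0; [exact: S_sym | exact: S_psd].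
rewrite mulr1; apply: ler_sum => k _.
rewrite exprMn mulrAC ler_wpM2l //.
by have := Bs w (set_mem wB) k; rewrite /S -big_enum.
Qed.

End MatrixChernoff.

(** * Measurability of the events *)

Lemma continuous_sum (R : realType) (T : topologicalType) (I : Type) (r : seq I)
    (F : I -> T -> R) :
  (forall i, continuous (F i)) -> continuous (fun x => \sum_(i <- r) F i x).
Proof.
move=> cF; elim: r => [|i r IH].
  by under eq_fun do rewrite big_nil; exact: cst_continuous.
under eq_fun do rewrite big_cons.
by move=> x; apply: cvgD; [exact: cF | exact: IH].
Qed.

Lemma continuous_qform (R : realType) (m : nat) (A : 'M[R]_m) :
  continuous (fun x : 'cV[R]_m => qform A x).
Proof.
under eq_fun do rewrite qform_sumE.
apply: continuous_sum => a; apply: continuous_sum => b x.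
have c i : continuous (fun x : 'cV[R]_m => x i 0) by exact: coord_continuous.
exact: (cvgM (cvgM (c a x) (c b x)) (cvg_cst _)).
Qed.

(** By continuity a negative value would persist at a nearby rational vector. Semidefiniteness
    thereby becomes a countable family of conditions. *)
Lemma psd_of_rational_vectors (R : realType) (m : nat) (A : 'M[R]_m) :
  (forall x : 'cV[rat]_m, 0 <= qform A (map_mx ratr x)) -> psd A.
Proof.
move=> Aq x; rewrite leNgt; apply/negP => neg.
have /cvgr_lt/(_ _ neg) := @continuous_qform _ _ A x.
move=> /nbhs_ballP[e e0 xe].
have /choice[q xq] (a : 'I_m) : exists r : rat, `|x a 0 - ratr r| < e.
  have xe' : x a 0 - e < x a 0 + e by have := e0; rewrite /=; lra.
  have [r] := rat_in_itvoo xe'.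
  by rewrite in_itv /= => re; exists r; rewrite distrC ltr_distl.
have := xe (map_mx ratr (\col_a q a)); rewrite /= ltNge Aq.
suff : ball x e (map_mx ratr (\col_a q a)) by move=> /[swap] /[apply].
by split => // a b; rewrite !mxE ord1; exact: xq.
Qed.

Section MeasurableMatrix.
Context (R : realType) (d : measure_display) (T : measurableType d).

Lemma measurable_forall (I : countType) (Q : I -> set T) :
  (forall i, measurable (Q i)) -> measurable [set w | forall i, Q i w].
Proof.
move=> mQ; pose F k := if unpickle k is Some i then Q i else setT.
have -> : [set w | forall i, Q i w] = \bigcap_k F k.
  apply/seteqP; split => [w Qw k _|w Fw i].
    by rewrite /F; case: unpickle.
  by have := Fw (pickle i) Logic.I; rewrite /F pickleK.
by apply: bigcapT_measurable => k; rewrite /F; case: unpickle.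
Qed.

Lemma measurable_inv (f : T -> R) : measurable_fun setT f ->
  measurable_fun setT (fun w => (f w)^-1).
Proof.
(* Writes 1/f as f times a real power of f^2, a measurable expression; where [f] vanishes both sides
   are 0. *)
move=> mf; have -> : (fun w => (f w)^-1) = (fun w => f w * (f w ^+ 2) `^ (-1)).
  apply/funext => w; rewrite powR_inv1 ?sqr_ge0 // expr2 invfM mulrA.
  have [->|f0] := eqVneq (f w) 0; first by rewrite invr0 mulr0.
  by rewrite mulfV // mul1r.
apply: measurable_funM => //.
apply: (@measurableT_comp _ _ _ _ _ _ (fun x : R => x `^ (-1))).
  exact: measurable_powR.
exact: measurable_funX.
Qed.

Lemma measurable_det k (M : T -> 'M[R]_k) :
  (forall i j, measurable_fun setT (fun w => M w i j)) ->
  measurable_fun setT (fun w => \det (M w)).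
Proof.
move=> mM; apply: (measurable_sum _ (h := fun (s : 'S_k) w =>
  (-1) ^+ s * \prod_i M w i (s i))) => s.
apply: measurable_funM => //.
by apply: (measurable_prod (h := fun i w => M w i (s i))) => i _; exact: mM.
Qed.

Lemma measurable_trace_invmx k (M : T -> 'M[R]_k) :
  (forall w, M w \in unitmx) ->
  (forall i j, measurable_fun setT (fun w => M w i j)) ->
  measurable_fun setT (fun w => \tr (invmx (M w))).
Proof.
move=> uM mM.
(* By the adjugate formula the trace is the sum of the principal minors of order k - 1 divided by
   the determinant. *)
have -> : (fun w => \tr (invmx (M w))) = (fun w => (\det (M w))^-1 *
    \sum_(i < k) (-1) ^+ (i + i) * \det (row' i (col' i (M w)))).
  apply/funext => w; rewrite /invmx uM linearZ /= /mxtrace; congr (_ * _).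
  by apply: eq_bigr => i _; rewrite mxE.
apply: measurable_funM; first by apply: measurable_inv; exact: measurable_det.
apply: (measurable_sum _ (h := fun (i : 'I_k) w =>
  (-1) ^+ (i + i) * \det (row' i (col' i (M w))))) => i.
apply: measurable_funM => //; apply: measurable_det => a b.
by under eq_fun do rewrite !mxE; exact: mM.
Qed.

End MeasurableMatrix.

Section MeasurableEvents.
Context (R : realType) (n m : nat) (d : measure_display) (Omega : measurableType d).
Variables (P : 'M[R]_m) (sigma2 : 'I_n -> R) (h : 'I_n -> Omega -> 'cV[R]_m).
Hypotheses (n_ge2 : (2 <= n)%N) (m_gt0 : (0 < m)%N).
Hypotheses (P_posdef : sym_posdef P) (sigma2_gt0 : forall j, 0 < sigma2 j).
Hypothesis mh : forall j a, measurable_fun setT (fun w => h j w a 0).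

Lemma measurable_spectral_condition phi :
  measurable [set w | spectral_condition P sigma2 (fun j => h j w) phi].
Proof.
rewrite /spectral_condition; set c := _ * _.
(* The condition says that c I - H^T H is positive semidefinite, which rational test vectors
   decide. *)
pose Q (x : 'cV[rat]_m) : set Omega := [set w |
  \sum_j ((h j w)^T *m map_mx ratr x) 0 0 ^+ 2 <= c * sqnorm2 (map_mx ratr x)].
have -> : [set w | lambda_max ((measurement_mx (fun j => h j w))^T *m
    measurement_mx (fun j => h j w)) <= c] = [set w | forall x, Q x w].
  apply/seteqP; split => w /=.
    move=> /(lambda_max_leP (gram_sym _) m_gt0) qc x.
    by rewrite /Q /= -(qform_gram (fun j => h j w)); exact: qc.
  move=> Qw; apply/(lambda_max_leP (gram_sym _) m_gt0) => x.
  set A := _ *m _.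
  have : psd (c *: (1 : 'M[R]_m) - A).
    apply: psd_of_rational_vectors => y; rewrite qformD -scaleN1r !qformZ.
    by rewrite mulN1r subr_ge0 qform1 qform_gram; exact: Qw.
  move=> /(_ x); rewrite qformD -scaleN1r !qformZ mulN1r subr_ge0.
  by rewrite qform1.
apply: measurable_forall => x; rewrite /Q.
rewrite -[X in measurable X]setTI; apply: measurable_fun_ler => //.
apply: (measurable_sum _ (h := fun j w => ((h j w)^T *m map_mx ratr x) 0 0 ^+ 2)) => j.
apply: measurable_funX; under eq_fun do rewrite mxE.
apply: (measurable_sum _ (h := fun a w => (h j w)^T 0 a * map_mx ratr x a 0)) => a.
by apply: measurable_funM => //; under eq_fun do rewrite mxE; exact: mh.
Qed.

Lemma measurable_trace_objective S :
  measurable_fun setT (fun w => trace_objective P sigma2 (fun j => h j w) S).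
Proof.
rewrite /trace_objective; under eq_fun do rewrite linearB.
apply: measurable_funB => //; apply: measurable_trace_invmx.
  by move=> w; exact: information_mx_unit.
move=> a b; rewrite /information_mx; under eq_fun do rewrite mxE summxE.
apply: measurable_funD => //.
have -> : (fun w => \sum_(i in S) ((sigma2 i)^-1 *: (h i w *m (h i w)^T)) a b) =
    (fun w => \sum_(i <- enum S) (sigma2 i)^-1 * (h i w a 0 * h i w b 0)).
  apply/funext => w; rewrite big_enum; apply: eq_bigr => i _.
  by rewrite !mxE big_ord1 !mxE.
apply: measurable_sum => i; apply: measurable_funM => //.
exact: measurable_funM.
Qed.

Lemma measurable_curvature_bound C phi :
  measurable [set w | curvature_bound P sigma2 (fun j => h j w) C phi].
Proof.
rewrite /curvature_bound; set c := sup _.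
pose f w := trace_objective P sigma2 (fun j => h j w).
pose Q (p : {set 'I_n} * {set 'I_n} * 'I_n) : set Omega :=
  [set w | p.1.1 \proper p.1.2 -> p.2 \notin p.1.2 ->
           marginal (f w) p.2 p.1.2 / marginal (f w) p.2 p.1.1 <= c].
have -> : [set w | curvature_max (f w) <= c] = [set w | forall p, Q p w].
  apply/seteqP; split => w /=.
    by move=> /(curvature_le_iff _ _ n_ge2) H [[S T] i] /=; exact: H.
  by move=> Qw; apply/(curvature_le_iff _ _ n_ge2) => S T i; exact: (Qw (S, T, i)).
apply: measurable_forall => -[[S T] i]; rewrite /Q /=.
case: (boolP (S \proper T)) => [ST|ST]; last first.
  by rewrite [X in measurable X](_ : _ = setT) //; apply/seteqP; split.
case: (boolP (i \notin T)) => [iT|iT]; last first.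
  by rewrite [X in measurable X](_ : _ = setT) //; apply/seteqP; split.
rewrite [X in measurable X](_ : _ =
    [set w | marginal (f w) i T / marginal (f w) i S <= c]); last first.
  by apply/seteqP; split => w /=; [move=> H; exact: H | move=> H _ _].
rewrite -[X in measurable X]setTI; apply: measurable_fun_ler => //.
have mm U : measurable_fun setT (fun w => marginal (f w) i U).
  by apply: measurable_funB; exact: measurable_trace_objective.
by apply: measurable_funM => //; exact: measurable_inv.
Qed.

End MeasurableEvents.

(** * The choice of phi *)

Section PhiChoice.
Variables (R : realType) (n : nat) (sigma2 : 'I_n -> R) (lambda s : R).
Hypotheses (n_gt0 : (0 < n)%N) (sigma2_gt0 : forall j, 0 < sigma2 j).
Hypotheses (lambda_gt0 : 0 < lambda) (s_gt0 : 0 < s).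

Let phi := inf (range (fun j => (lambda^-1 + s / sigma2 j)^-1)).

(** The function x -> (1/lambda + s/x)^-1 is increasing, so its minimum over the variances occurs at
    the least one; there the threshold of the spectral condition is exactly [s]. *)
Lemma phi_choice :
  [/\ 0 < phi, phi < lambda & (phi^-1 - lambda^-1) * inf (range sigma2) = s].
Proof.
have [j phiE phi_min] :=
  inf_range_attained (fun j => (lambda^-1 + s / sigma2 j)^-1) n_gt0.
have [k sE s_min] := inf_range_attained sigma2 n_gt0.
have lV0 : 0 < lambda^-1 by rewrite invr_gt0.
have d0 i : 0 < s / sigma2 i by rewrite divr_gt0.
have a0 i : 0 < lambda^-1 + s / sigma2 i by rewrite addr_gt0.
rewrite /phi phiE sE; split; first by rewrite invr_gt0.
  by rewrite -[ltRHS]invrK ltf_pV2 ?posrE // ltrDl.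
have -> : sigma2 k = sigma2 j.
  apply/eqP; rewrite eq_le s_min /=.
  have := phi_min k; rewrite lef_pV2 ?posrE // lerD2l ler_pM2l //.
  by rewrite lef_pV2 ?posrE.
by rewrite invrK addrC addKr divfK // gt_eqF.
Qed.

End PhiChoice.

(** * Part (ii): the tail bound and the probability of the good event *)

Section RandomSensors.
Context (R : realType) (n m : nat) (d : measure_display).
Context (Omega : measurableType d) (Pr : probability Omega R).
Variables (P : 'M[R]_m) (sigma2 : 'I_n -> R) (h : 'I_n -> {RV Pr >-> borel_cV R m}).
Variables (v C : R).
Hypotheses (n_ge2 : (2 <= n)%N) (m_gt0 : (0 < m)%N).
Hypothesis h_indep : independent_vectors h.
Hypothesis h_mean : forall j, zero_mean Pr (h j).
Hypothesis h_cov : forall j, has_covariance_mx Pr (h j) (v%:M).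
Hypothesis v_lt : v < C.
Hypothesis h_bound : forall j, {ae Pr, forall w, sqnorm2 (h j w) <= C}.

Lemma covariance_scalar_ge0 : 0 <= v.
Proof.
have := h_cov (Ordinal (ltnW n_ge2)) (Ordinal m_gt0) (Ordinal m_gt0).
rewrite mxE eqxx mulr1n unlock => cE; rewrite -lee_fin -cE.
by apply: expectation_ge0 => w; rewrite -[leRHS]/(_ w * _ w) -expr2 sqr_ge0.
Qed.

Let mh j a : measurable_fun setT (fun w => (h j w : 'cV[R]_m) a 0).
Proof. exact: (measurableT_comp (measurable_entry a)). Qed.

Let bounded_event := [set w | forall j : 'I_n, sqnorm2 (h j w) <= C].

Let measurable_bounded_event : measurable bounded_event.
Proof.
apply: measurable_forall => j.
rewrite -[X in measurable X]setTI; apply: measurable_fun_ler => //.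
by apply: (measurableT_comp (@measurable_sqnorm2 R m)).
Qed.

Let bounded_event_ae : Pr (~` bounded_event) = 0%E.
Proof.
have : {ae Pr, forall w, bounded_event w}.
  by apply: filter_forall => j; exact: h_bound.
by move=> /negligibleP; apply; exact: measurableC.
Qed.

Variable q : R.
Hypothesis q_gt0 : 0 < q.

Lemma gram_tail_bound (B : set Omega) : measurable B ->
  (forall w, B w -> n%:R * v + q <
     lambda_max ((measurement_mx (fun j => h j w))^T *m
                 measurement_mx (fun j => h j w))) ->
  (Pr B <= (m%:R * expR ((- q ^+ 2 / 2) /
               ((C - v) * (n%:R * v + q / 3))))%:E)%E.
Proof.
move=> mB Bgt; set rhs := m%:R * _.
have v0 := covariance_scalar_ge0.
have C0 : 0 < C by exact: le_lt_trans v0 v_lt.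
have n0 : (0 < n)%N by exact: ltnW.
pose t := q / ((C - v) * (n%:R * v + q / 3)).
have nv0 : 0 <= n%:R * v by rewrite mulr_ge0.
have t0 : 0 <= t.
  by rewrite divr_ge0 ?mulr_ge0 ?subr_ge0 ?addr_ge0 ?divr_ge0 // ltW.
have mBb : measurable (B `&` bounded_event) by exact: measurableI.
have s0 : 0 <= n%:R * v + q by rewrite addr_ge0 // ltW.
have H := matrix_chernoff h_indep h_mean h_cov h_bound C0 mBb t0 v0 s0.
(* Intersecting with [bounded_event] costs no probability and makes truncation the identity, so the
   truncated sum is the Gram matrix itself. *)
apply: (@le_trans _ _ (Pr (B `&` bounded_event))).
  rewrite (measureDI Pr mB measurable_bounded_event) [X in (X + _)%E](_ : _ = 0%E).
    by rewrite add0e.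
  apply: (subset_measure0 _ _ _ bounded_event_ae);
    [exact: measurableD | exact: measurableC |].
  by move=> w [].
rewrite -[leLHS]fineK ?fin_num_measure // lee_fin.
rewrite -(ler_pM2r (expR_gt0 (t * (n%:R * v + q)))).
apply: le_trans (H _) _; last first.
  rewrite /rhs -[leRHS]mulrA ler_wpM2l // [leRHS]mulrC.
  exact: bernstein_exponent.
move=> w [Bw bw] k.
have -> : \sum_j truncate C (h j w) *m (truncate C (h j w))^T =
    (measurement_mx (fun j => h j w))^T *m measurement_mx (fun j => h j w).
  by rewrite gram_measurement_mxE; apply: eq_bigr => j _; rewrite truncate_id.
apply: trace_exp_ge => //; [exact: gram_sym | | exact: Bgt].
by move=> x; rewrite qform_gram sumr_ge0 // => j _; exact: sqr_ge0.
Qed.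

Hypotheses (P_posdef : sym_posdef P) (sigma2_gt0 : forall j, 0 < sigma2 j).

(** By the hypothesis on [phi], failure of the spectral condition is exactly the tail event of
    [gram_tail_bound]. Where the condition and the norm bounds hold, part (i) applies outcome by
    outcome. *)
Lemma curvature_bound_probability (phi : R) : 0 < phi -> phi < lambda_min P ->
  (phi^-1 - (lambda_min P)^-1) * inf (range sigma2) = n%:R * v + q ->
  let E := [set w | spectral_condition P sigma2 (fun j => h j w) phi /\
                    curvature_bound P sigma2 (fun j => h j w) C phi] in
  measurable E /\
  ((1 - m%:R * expR ((- q ^+ 2 / 2) /
      ((C - v) * (n%:R * v + q / 3))))%:E <= Pr E)%E.
Proof.
move=> phi_gt0 phi_lt phiE E.
have mS := measurable_spectral_condition P sigma2 m_gt0 mh phi.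
have mE : measurable E.
  apply: measurableI => //.
  exact: (measurable_curvature_bound n_ge2 m_gt0 P_posdef sigma2_gt0 mh).
split => //.
set S := [set w | _] in mS.
have tail : (Pr (~` S) <= (m%:R * expR ((- q ^+ 2 / 2) /
    ((C - v) * (n%:R * v + q / 3))))%:E)%E.
  apply: gram_tail_bound; first exact: measurableC.
  by move=> w /= Sw; rewrite -phiE ltNge; apply/negP.
apply: (@le_trans _ _ (Pr S)).
  rewrite -[S]setCK probability_setC ?EFinB; last exact: measurableC.
  by rewrite leeB.
apply: (@le_trans _ _ (Pr (S `&` bounded_event))).
  rewrite (measureDI Pr mS measurable_bounded_event) [X in (X + _)%E](_ : _ = 0%E).
    by rewrite add0e.
  apply: (subset_measure0 _ _ _ bounded_event_ae);
    [exact: measurableD | exact: measurableC |].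
  by move=> w [].
apply: le_measure; rewrite ?inE //; first exact: measurableI.
move=> w [Sw bw]; split => //.
exact: curvature_bound_of_spectral.
Qed.

End RandomSensors.

Theorem theorem1 (R : realType) (n m : nat) (hn : (2 <= n)%N) (hm : (1 <= m)%N)
    (P : 'M[R]_m) (hP : sym_posdef P)
    (sigma2 : 'I_n -> R) (hsigma2 : forall j : 'I_n, 0 < sigma2 j) (C : R) :
  (forall h : 'I_n -> 'cV[R]_m,
     (forall j : 'I_n, sqnorm2 (h j) <= C) ->
     forall phi : R, 0 < phi -> phi < lambda_min P ->
       spectral_condition P sigma2 h phi ->
       curvature_bound P sigma2 h C phi)
  /\
  (forall (d : measure_display) (Omega : measurableType d)
      (Pr : probability Omega R)
      (h : 'I_n -> {RV Pr >-> borel_cV R m}) (sigmah2 : R),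
     independent_vectors h ->
     identically_distributed h ->
     (forall j : 'I_n, zero_mean Pr (h j)) ->
     (forall j : 'I_n, has_covariance_mx Pr (h j) (sigmah2%:M)) ->
     sigmah2 < C ->
     (forall j : 'I_n, {ae Pr, forall w, sqnorm2 (h j w) <= C}) ->
     forall q : R, 0 < q ->
       let phi : R := inf (range (fun j : 'I_n =>
         ((lambda_min P)^-1 + (n%:R * sigmah2 + q) / sigma2 j)^-1)) in
       let E : set Omega :=
         [set w | spectral_condition P sigma2 (fun j => h j w) phi /\
                  curvature_bound P sigma2 (fun j => h j w) C phi] in
       [/\ 0 < phi, phi < lambda_min P, measurable E &
           ((1 - m%:R * expR ((- q ^+ 2 / 2) /
               ((C - sigmah2) * (n%:R * sigmah2 + q / 3))))%:E <= Pr E)%E]).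
Proof.
split=> [h hC phi|d Omega Pr h v h_indep _ h_mean h_cov vC h_bound q q0 phi E].
  exact: curvature_bound_of_spectral.
have v0 := covariance_scalar_ge0 hn hm h_cov.
(* As a variance, [v] is nonnegative, so q > 0 gives the strict inequality that keeps phi below
   lambda_min(P). *)
have s0 : 0 < n%:R * v + q by rewrite ltr_wpDl // mulr_ge0.
have [phi0 phi_lt phiE] :=
  phi_choice (ltnW hn) hsigma2 (lambda_min_gt0 hm hP) s0.
have [mE PE] := curvature_bound_probability hn hm h_indep h_mean h_cov vC h_bound
  q0 hP hsigma2 phi0 phi_lt phiE.
by split.
Qed.
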